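(* For all integers $n\geq 1$: $\overline{pl}_4(12n)\equiv 0\pmod 8$, $\overline{pl}_4(6n+3)\equiv 0\pmod 8$, $\overline{pl}_8(210n)\equiv 0\pmod 8$, $\overline{pl}_8(210n+3)\equiv 0\pmod 8$, $\overline{pl}_8(210n+9)\equiv 0\pmod 8$, and $\overline{pl}_8(210n+105)\equiv 0\pmod 8$.
   Context: A plane overpartition of $n$ is a plane partition of $n$ (an array $(\pi_{ij})_{i,j\geq1}$ of nonnegative integers, weakly decreasing along rows and down columns, with $\sum\pi_{ij}=n$) in which entries may be overlined subject to: in each row, the last occurrence of an integer may be overlined or not and all other occurrences of that integer in the row are not overlined; in each column, the first occurrence of an integer may be overlined or not and all other occurrences of that integer in the column are overlined. A $k$-rowed plane overpartition is a plane overpartition with at most $k$ (nonzero) rows; $\overline{pl}_k(n)$ is their number ($\overline{pl}_k(0)=1$), with generating function $\sum_{n\geq0}\overline{pl}_k(n)q^n=\prod_{n\geq1}\left(\frac{1+q^n}{1-q^n}\right)^{\min\{k,n\}}$. *)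

(* Defs.v *)
From mathcomp Require Import all_boot.

Set Implicit Arguments.
Unset Strict Implicit.
Unset Printing Implicit Defensive.

(* An array (pi_ij) of nonnegative integers together with overline marks.
   If pi_ij > 0 (indices from 0) in a plane partition of n, then the i + j + 1
   entries pi_{0,0}, ..., pi_{i,0} and pi_{0,1}, ..., pi_{0,j} are positive, so
   i, j < n, and every entry is at most n.  Hence an infinite array that is a
   plane partition of n is the same thing as its n x n corner with entries in
   {0, ..., n}; for n = 0 the corner is empty and there is exactly one array. *)
Definition overarray (n : nat) := {ffun 'I_n * 'I_n -> 'I_n.+1 * bool}.

Definition entry (n : nat) (a : overarray n) (i j : 'I_n) : nat := (a (i, j)).1.

Definition overlined (n : nat) (a : overarray n) (i j : 'I_n) : bool :=
  (a (i, j)).2.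

Definition plane_partition (n : nat) (a : overarray n) : bool :=
  [&& [forall i : 'I_n, forall j : 'I_n, forall j' : 'I_n,
         (j <= j') ==> (entry a i j' <= entry a i j)],
      [forall i : 'I_n, forall i' : 'I_n, forall j : 'I_n,
         (i <= i') ==> (entry a i' j <= entry a i j)]
    & \sum_(i < n) \sum_(j < n) entry a i j == n].

(* Only positive entries are parts: zeros carry no overline and are exempt from
   the column rule. *)
Definition overline_support (n : nat) (a : overarray n) : bool :=
  [forall i : 'I_n, forall j : 'I_n, overlined a i j ==> (0 < entry a i j)].

(* An entry that is not the last occurrence of its value in its row is not
   overlined; the last occurrence is unconstrained by its row. *)
Definition overline_rows (n : nat) (a : overarray n) : bool :=
  [forall i : 'I_n, forall j : 'I_n, forall j' : 'I_n,
     [&& 0 < entry a i j, j < j' & entry a i j' == entry a i j]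
       ==> ~~ overlined a i j].

(* An entry that is not the first occurrence of its value in its column is
   overlined; the first occurrence is unconstrained by its column. *)
Definition overline_cols (n : nat) (a : overarray n) : bool :=
  [forall i : 'I_n, forall i' : 'I_n, forall j : 'I_n,
     [&& 0 < entry a i' j, i < i' & entry a i j == entry a i' j]
       ==> overlined a i' j].

Definition plane_overpartition (n : nat) (a : overarray n) : bool :=
  [&& plane_partition a, overline_support a, overline_rows a
    & overline_cols a].

(* Columns decrease, so the nonzero rows are the topmost ones and having at
   most k of them means that the rows of index >= k (from 0) vanish. *)
Definition at_most_rows (k n : nat) (a : overarray n) : bool :=
  [forall i : 'I_n, forall j : 'I_n, (k <= i) ==> (entry a i j == 0)].

Definition pl_over (k n : nat) : nat :=
  #|[set a : overarray n | plane_overpartition a && at_most_rows k a]|.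

(* Main.v *)
(** Fix the underlying plane partition.  A positive entry that is followed in its
    row by an equal entry must be plain, one that lies below an equal entry must
    be overlined, an entry subject to both rules makes overlining impossible, and
    the remaining entries are free.  Hence [pl_over k n] is the sum of
    [2 ^ (number of free cells)] over the plane partitions of [n] with at most
    [k] rows and no conflicting cell.  Every value that occurs has a free cell, so
    modulo 8 only two families matter: a hook filled with one value, which has one
    free cell, and a hook filled with [a + b] surrounded by a ribbon filled with
    [b], which has two.  If the hook has [s1] cells and the ribbon [s2], the latter
    are counted by the solutions of [a s1 + b (s1 + s2) = n] with [a, b > 0].

    In terms of beads, adding a ribbon moves one bead up to an unoccupied place,
    and this gives the parity of the number of hook-ribbon pairs of sizes [s1] and
    [s2] with at most [k] rows: for even [k] it is symmetric in [s1] and [s2].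
    Let [G (x, y)] be the number of solutions of [a x + b y = n].  Comparing [a]
    with [b] gives [G (x, y) = G (x, x + y) + G (y, x + y) + [x + y | n]], so that
    the sum over all sizes telescopes.  When 4 divides [k], what remains modulo 8
    only involves [G (r, s)] for odd [r < s < k] and conditions [d | n] with [d]
    dividing twice a number below [k].  This is periodic in [n], of period 12 when
    [k = 4] and 840 when [k = 8], and finitely many residues are then evaluated. *)

Require Import Defs.
From mathcomp Require Import all_boot.
From mathcomp Require Import zify.

Set Implicit Arguments.
Unset Strict Implicit.
Unset Printing Implicit Defensive.

(** * Finite sums and cardinals *)

Lemma ltn_ext a b : (forall c, (c < a) = (c < b)) -> a = b.
Proof. by move=> eq_lt; have := eq_lt a; have := eq_lt b; rewrite !ltnn; lia. Qed.

Lemma sum_eq_ord n m : \sum_(i < n) (i == m :> nat : nat) = (m < n).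
Proof. by rewrite -big_mkcond /= (big_ord1_eq addn (fun=> 1)); case: ltnP. Qed.

Lemma sum_if_ltn n w a : \sum_(c < n) (if c < w then a else 0) = a * minn w n.
Proof.
rewrite -(big_mkord xpredT (fun c => if c < w then a else 0)).
elim: n => [|n IH]; first by rewrite big_geq // minn0 muln0.
rewrite big_nat_recr //= IH; case: leqP => lt_wn; case: leqP; rewrite ?addn0; nia.
Qed.

Lemma sum_ltn n w : \sum_(c < n) (c < w : nat) = minn w n.
Proof. by rewrite -[RHS]mul1n -sum_if_ltn. Qed.

Lemma sum_double n (F : nat -> nat) :
  \sum_(i < n.*2) F i = \sum_(i < n) F i.*2 + \sum_(i < n) F i.*2.+1.
Proof.
elim: n => [|n IH]; first by rewrite !big_ord0.
by rewrite doubleS !big_ord_recr /= IH addnACA addnA.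
Qed.

Lemma eq_sum_trunc a b (F : nat -> nat) : (forall i, minn a b <= i -> F i = 0) ->
  \sum_(i < a) F i = \sum_(i < b) F i.
Proof.
have trunc c d : c <= d -> (forall i, c <= i -> F i = 0) ->
    \sum_(i < d) F i = \sum_(i < c) F i.
  move=> /subnKC <- F0; rewrite big_split_ord /= [X in _ + X]big1 ?addn0 // => i _.
  by rewrite F0 ?leq_addr.
move=> F0; have [le_ab|/ltnW le_ba] := leqP a b.
  by apply/esym/trunc => // i le_ai; rewrite F0 // geq_min le_ai.
by apply: trunc => // i le_bi; rewrite F0 // geq_min le_bi orbT.
Qed.

Lemma eq_odd_sum (I : Type) (r : seq I) (P : pred I) (F G : I -> nat) :
  (forall i, P i -> odd (F i) = odd (G i)) ->
  odd (\sum_(i <- r | P i) F i) = odd (\sum_(i <- r | P i) G i).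
Proof.
by move=> eqFG; elim/big_rec2: _ => // i x y Pi eq_xy; rewrite !oddD eqFG // eq_xy.
Qed.

Lemma sum_iota (P : pred nat) n (F : nat -> nat) :
  \sum_(i < n | P i) F i = sumn [seq F i | i <- iota 0 n & P i].
Proof. by rewrite sumnE big_map big_filter -(big_mkord P) /index_iota subn0. Qed.

Lemma card_dep_pair (A B : finType) (P : pred A) (Q : A -> pred B) :
  #|[set t : A * B | P t.1 && Q t.1 t.2]| = \sum_(a | P a) #|[set b | Q a b]|.
Proof.
rewrite cardsE -sum1_card -(pair_big_dep P Q (fun _ _ => 1)) /=.
by apply: eq_bigr => a _; rewrite sum1_card cardsE.
Qed.

(** * Free cells *)

Notation weakly_decreasing la := {homo la : l l' / l <= l' >-> l' <= l}.

Lemma weakly_decreasingS (la : nat -> nat) :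
  (forall l, la l.+1 <= la l) -> weakly_decreasing la.
Proof. by apply: homo_leq => // y x z le_yx le_zy; apply: leq_trans le_zy le_yx. Qed.

Section Cells.
Variable f : nat -> nat -> nat.

Definition repeats_right (i j : nat) : bool :=
  (0 < f i j) && (f i j.+1 == f i j).

Definition repeats_above (i j : nat) : bool :=
  [&& 0 < f i j, 0 < i & f i.-1 j == f i j].

Definition free_cell (i j : nat) : bool :=
  [&& 0 < f i j, ~~ repeats_right i j & ~~ repeats_above i j].

Definition clash_cell (i j : nat) : bool :=
  repeats_right i j && repeats_above i j.

Definition decreasing_array : Prop :=
  forall i j, f i j.+1 <= f i j /\ f i.+1 j <= f i j.

Hypothesis f_decr : decreasing_array.

Lemma decreasing_array_row i : weakly_decreasing (f i).
Proof. by apply: weakly_decreasingS => j; case: (f_decr i j). Qed.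

Lemma decreasing_array_col j : weakly_decreasing (f^~ j).
Proof. by apply: weakly_decreasingS => i; case: (f_decr i j). Qed.

Lemma decreasing_array_le00 i j : f i j <= f 0 0.
Proof.
by rewrite (leq_trans (decreasing_array_row i (leq0n j))) // decreasing_array_col.
Qed.

(* The last occurrence of a value in the topmost row that contains it is free. *)
Lemma free_cell_of_value n l c :
  (forall i j, n <= j -> f i j = 0) -> 0 < f l c ->
  exists i j, free_cell i j /\ f i j = f l c.
Proof.
move=> f_cols; set v := f l c => v_gt0.
have lt_n i j : f i j = v -> j < n.
  by move=> fij; rewrite ltnNge; apply/negP => /(f_cols i); lia.
pose row_has i := has (fun j => f i j == v) (iota 0 n).
have row_hasP i j : f i j = v -> row_has i.
  by move=> fij; apply/hasP; exists j; rewrite ?mem_iota ?fij //= (lt_n i).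
have [i /hasP[j0 _ fij0] i_min] := ex_minnP (ex_intro row_has l (row_hasP l c erefl)).
have j_le j : f i j == v -> j <= n by move=> /eqP /lt_n /ltnW.
have [j /eqP fij j_max] := ex_maxnP (ex_intro _ j0 fij0) j_le.
exists i, j; split=> //; rewrite /free_cell /repeats_right /repeats_above fij v_gt0 /=.
apply/andP; split; first by apply/negP => /j_max; rewrite ltnn.
by apply/negP => /andP[i_gt0 /eqP /row_hasP /i_min]; lia.
Qed.

End Cells.

Lemma free_cell_ext f g i j : f =2 g -> free_cell f i j = free_cell g i j.
Proof. by move=> fg; rewrite /free_cell /repeats_right /repeats_above !fg. Qed.

Lemma clash_cell_ext f g i j : f =2 g -> clash_cell f i j = clash_cell g i j.
Proof. by move=> fg; rewrite /clash_cell /repeats_right /repeats_above !fg. Qed.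

Notation filling n := {ffun 'I_n * 'I_n -> 'I_n.+1}.
Notation marking n := {ffun 'I_n * 'I_n -> bool}.

Definition part n (e : filling n) (i j : nat) : nat :=
  if insub i is Some i' then if insub j is Some j' then e (i', j') : nat else 0
  else 0.

Lemma part_ord n (e : filling n) (i j : 'I_n) : part e i j = e (i, j).
Proof. by rewrite /part !valK. Qed.

Lemma part_row_out n (e : filling n) i j : n <= i -> part e i j = 0.
Proof. by move=> le_ni; rewrite /part insubN // -leqNgt. Qed.

Lemma part_col_out n (e : filling n) i j : n <= j -> part e i j = 0.
Proof.
by move=> le_nj; rewrite /part (@insubN _ _ _ j) -?leqNgt //; case: insub.
Qed.

Lemma part_gt0_lt n (e : filling n) i j : 0 < part e i j -> (i < n) && (j < n).
Proof.
move=> pij; apply/andP; split; rewrite ltnNge; apply/negP => out; move: pij.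
  by rewrite part_row_out.
by rewrite part_col_out.
Qed.

Definition overlay n (eo : filling n * marking n) : overarray n :=
  [ffun c => (eo.1 c, eo.2 c)].

Lemma entry_overlay n (e : filling n) o i j : entry (overlay (e, o)) i j = part e i j.
Proof. by rewrite /entry ffunE part_ord. Qed.

Lemma overlined_overlay n (e : filling n) o i j :
  overlined (overlay (e, o)) i j = o (i, j).
Proof. by rewrite /overlined ffunE. Qed.

Lemma overlay_bij n : bijective (@overlay n).
Proof.
exists (fun a : overarray n => ([ffun c => (a c).1] : filling n,
                                [ffun c => (a c).2] : marking n)) => [[e o]|a].
  by congr (_, _); apply/ffunP => c; rewrite !ffunE.
by apply/ffunP => c; rewrite !ffunE; case: (a c).
Qed.

Definition plane_filling (k n : nat) (e : filling n) : bool :=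
  let a := overlay (e, [ffun=> false]) in plane_partition a && at_most_rows k a.

Lemma plane_filling_overlay k n (e : filling n) o :
  plane_partition (overlay (e, o)) && at_most_rows k (overlay (e, o))
  = plane_filling k e.
Proof.
have eE i j : entry (overlay (e, o)) i j = entry (overlay (e, [ffun=> false])) i j.
  by rewrite !entry_overlay.
rewrite /plane_filling /plane_partition; congr ([&& _, _ & _] && _).
- by do 3!apply: eq_forallb => ?; rewrite !eE.
- by do 3!apply: eq_forallb => ?; rewrite !eE.
- by congr (_ == _); do 2!apply: eq_bigr => ? _; rewrite eE.
- by do 2!apply: eq_forallb => ?; rewrite eE.
Qed.

Lemma plane_fillingP k n (e : filling n) :
  reflect [/\ decreasing_array (part e), forall i j, k <= i -> part e i j = 0
            & \sum_(i < n) \sum_(j < n) part e i j = n]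
          (plane_filling k e).
Proof.
have sumE : \sum_(i < n) \sum_(j < n) entry (overlay (e, [ffun=> false])) i j
          = \sum_(i < n) \sum_(j < n) part e i j.
  by do 2!apply: eq_bigr => ? _; rewrite entry_overlay.
apply: (iffP andP) => [[/and3P[/'forall_'forall_forallP row_decr
   /'forall_'forall_forallP col_decr /eqP e_sum] /'forall_forallP e_rows]
  |[e_decr e_rows e_sum]].
- split=> [i j|i j le_ki|]; last by rewrite -sumE.
    split.
      have [j_lt|/part_col_out->//] := ltnP j.+1 n.
      have [i_lt|i_ge] := ltnP i n; last by rewrite !part_row_out.
      have := row_decr (Ordinal i_lt) (Ordinal (ltnW j_lt)) (Ordinal j_lt).
      by rewrite leqnSn !entry_overlay.
    have [i_lt|i_ge] := ltnP i.+1 n; last by rewrite part_row_out.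
    have [j_lt|j_ge] := ltnP j n; last by rewrite !part_col_out.
    have := col_decr (Ordinal (ltnW i_lt)) (Ordinal i_lt) (Ordinal j_lt).
    by rewrite leqnSn !entry_overlay.
  have [i_lt|/part_row_out->//] := ltnP i n.
  have [j_lt|/part_col_out->//] := ltnP j n.
  by have := e_rows (Ordinal i_lt) (Ordinal j_lt); rewrite le_ki entry_overlay => /eqP.
- split; first (apply/and3P; split).
  + apply/'forall_'forall_forallP => i j j'; apply/implyP => le_jj'.
    by rewrite !entry_overlay decreasing_array_row.
  + apply/'forall_'forall_forallP => i i' j; apply/implyP => le_ii'.
    by rewrite !entry_overlay decreasing_array_col.
  + by rewrite sumE e_sum.
  + apply/'forall_forallP => i j; apply/implyP => le_ki.
    by rewrite entry_overlay e_rows.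
Qed.

Definition allowed_marks n (e : filling n) (c : 'I_n * 'I_n) : pred bool :=
  fun b => [&& b ==> (0 < part e c.1 c.2), repeats_right (part e) c.1 c.2 ==> ~~ b
             & repeats_above (part e) c.1 c.2 ==> b].

Lemma plane_overpartition_overlay k n (e : filling n) o :
  plane_overpartition (overlay (e, o)) && at_most_rows k (overlay (e, o))
  = plane_filling k e && (o \in family (allowed_marks e)).
Proof.
rewrite /plane_overpartition andbAC plane_filling_overlay.
case: plane_fillingP => //= -[e_decr _ _].
apply/and3P/familyP => [[/'forall_forallP supp /'forall_'forall_forallP rows
   /'forall_'forall_forallP cols] [i j]|allowed].
- rewrite -topredE /=; apply/and3P; split => /=.
  + by have := supp i j; rewrite overlined_overlay entry_overlay.
  + apply/implyP => /andP[p_gt0 /eqP pE].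
    have /andP[_ j_lt] : (i < n) && (j.+1 < n) by apply: (@part_gt0_lt _ e); rewrite pE.
    have := rows i j (Ordinal j_lt).
    by rewrite overlined_overlay !entry_overlay p_gt0 /= ltnSn pE eqxx.
  + apply/implyP => /and3P[p_gt0 i_gt0 /eqP pE].
    have i_lt : i.-1 < n by rewrite (leq_ltn_trans (leq_pred _)).
    have := cols (Ordinal i_lt) i j.
    by rewrite overlined_overlay !entry_overlay p_gt0 /= pE eqxx prednK // leqnn.
- split.
  + apply/'forall_forallP => i j; rewrite overlined_overlay entry_overlay.
    by have /and3P[] := allowed (i, j).
  + apply/'forall_'forall_forallP => i j j'; apply/implyP => /and3P[].
    rewrite overlined_overlay !entry_overlay => p_gt0 lt_jj' /eqP pE.
    have /and3P[_ /implyP-> //] := allowed (i, j).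
    rewrite /repeats_right p_gt0 eqn_leq (proj1 (e_decr _ _)) /= -pE.
    exact: decreasing_array_row.
  + apply/'forall_'forall_forallP => i i' j; apply/implyP => /and3P[].
    rewrite overlined_overlay !entry_overlay => p_gt0 lt_ii' /eqP pE.
    have /and3P[_ _ /implyP-> //] := allowed (i', j).
    have i'_gt0 : 0 < i' by exact: leq_ltn_trans lt_ii'.
    rewrite /repeats_above p_gt0 i'_gt0 eqn_leq -{1}pE.
    by rewrite !decreasing_array_col ?leq_pred // -ltnS prednK.
Qed.

Definition free_cells n (e : filling n) : {set 'I_n * 'I_n} :=
  [set c : 'I_n * 'I_n | free_cell (part e) c.1 c.2].

Definition clash_free n (e : filling n) : bool :=
  [forall c : 'I_n * 'I_n, ~~ clash_cell (part e) c.1 c.2].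

Lemma card_allowed_marks n (e : filling n) c :
  #|allowed_marks e c| =
  if clash_cell (part e) c.1 c.2 then 0 else
  if free_cell (part e) c.1 c.2 then 2 else 1.
Proof.
rewrite -sum1_card /index_enum big_mkcond /= big_bool /= -!topredE /=.
rewrite /allowed_marks /clash_cell /free_cell /repeats_right /repeats_above.
by case: (0 < _) (_ == _) (0 < _) (_ == _) => [] [] [] [].
Qed.

Lemma card_family_allowed_marks n (e : filling n) :
  #|family (allowed_marks e)| = clash_free e * 2 ^ #|free_cells e|.
Proof.
rewrite card_family foldrE big_map big_enum /=.
have [/forallP no_clash|] := boolP (clash_free e).
  rewrite mul1n -sum1_card [in RHS]big_mkcond /= (big_morph _ (expnD 2) (expn0 2)).
  apply: eq_bigr => c _.
  by rewrite card_allowed_marks (negbTE (no_clash c)) inE; case: free_cell.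
rewrite negb_forall => /existsP[c]; rewrite negbK => clash_c.
by rewrite (bigD1 c) //= card_allowed_marks clash_c.
Qed.

Lemma pl_overE k n :
  pl_over k n = \sum_(e : filling n | plane_filling k e)
                  clash_free e * 2 ^ #|free_cells e|.
Proof.
rewrite /pl_over -(on_card_preimset (onW_bij _ (@overlay_bij n))).
transitivity #|[set eo | plane_filling k eo.1
                   && (eo.2 \in family (@allowed_marks n eo.1))]|.
  by apply: eq_card => -[e o]; rewrite !inE plane_overpartition_overlay.
rewrite (card_dep_pair _ (fun e o => o \in family (@allowed_marks n e))).
by apply: eq_bigr => e _; rewrite cardsE card_family_allowed_marks.
Qed.

Lemma plane_filling_part00_gt0 k n (e : filling n) :
  0 < n -> plane_filling k e -> 0 < part e 0 0.
Proof.
move=> n_gt0 /plane_fillingP[e_decr _ e_sum]; rewrite lt0n; apply/eqP => e00.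
move: n_gt0; rewrite -{}e_sum big1 // => i _; rewrite big1 // => j _.
by apply/eqP; rewrite -leqn0 -e00 decreasing_array_le00.
Qed.

Lemma mem_free_cells n (e : filling n) i j :
  free_cell (part e) i j ->
  exists2 c, c \in free_cells e & i = c.1 /\ j = c.2 :> nat.
Proof.
move=> free_ij; have /andP[i_lt j_lt] : (i < n) && (j < n).
  by apply: (@part_gt0_lt _ e); case/and3P: free_ij.
by exists (Ordinal i_lt, Ordinal j_lt); rewrite ?inE.
Qed.

Lemma free_cells_of_value k n (e : filling n) i j :
  plane_filling k e -> 0 < part e i j ->
  exists2 c, c \in free_cells e & part e i j = part e c.1 c.2.
Proof.
case/plane_fillingP=> e_decr _ _ /(free_cell_of_value (@part_col_out n e)).
by case=> [i' [j' [/mem_free_cells[c c_free [-> ->]] <-]]]; exists c.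
Qed.

Definition with_free_cells (k n r : nat) : {set filling n} :=
  [set e | [&& plane_filling k e, clash_free e & #|free_cells e| == r]].

Lemma pl_over_mod8_free_cells k n : 0 < n ->
  pl_over k n = 2 * #|with_free_cells k n 1| + 4 * #|with_free_cells k n 2| %[mod 8].
Proof.
move=> n_gt0; rewrite pl_overE.
have cardE r : #|with_free_cells k n r| =
    \sum_(e : filling n | plane_filling k e) (clash_free e && (#|free_cells e| == r)).
  rewrite -sum1_card big_mkcond [RHS]big_mkcond /=; apply: eq_bigr => e _.
  by rewrite inE; case: plane_filling => //=; case: (clash_free e && _).
pose rest (e : filling n) :=
  (clash_free e && (2 < #|free_cells e|)) * 2 ^ (#|free_cells e| - 3).
have weightE e : plane_filling k e -> clash_free e * 2 ^ #|free_cells e| =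
   2 * (clash_free e && (#|free_cells e| == 1)) +
   4 * (clash_free e && (#|free_cells e| == 2)) + 8 * rest e.
  move=> e_ok; have : 0 < #|free_cells e|.
    have [c c_free _] := free_cells_of_value e_ok (plane_filling_part00_gt0 n_gt0 e_ok).
    by rewrite card_gt0; apply/set0Pn; exists c.
  rewrite /rest; case: clash_free => //; case: #|free_cells e| => [|[|[|m]]] //= _.
  by rewrite !subSS subn0 !expnS; lia.
rewrite (eq_bigr _ weightE) 2!big_split /= -!big_distrr /= -!cardE.
by rewrite addnC mulnC modnMDl.
Qed.

(** * Ribbons *)

Definition empty_shape (l : nat) : nat := 0.

(* The skew shape [mu / la] contains no 2 x 2 square. *)
Definition thin (la mu : nat -> nat) : Prop := forall l, mu l.+1 <= (la l).+1.

(* Row [l] is the top row of a connected component of [mu / la]. *)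
Definition ribbon_start (la mu : nat -> nat) (l : nat) : bool :=
  (la l < mu l) && ((l == 0) || (mu l <= la l.-1)).

Lemma ribbon_start_empty mu l : ribbon_start empty_shape mu l = (l == 0) && (0 < mu 0).
Proof. by rewrite /ribbon_start /empty_shape; case: l => [|l] /=; lia. Qed.

Definition two_layer (a b : nat) (la mu : nat -> nat) (l c : nat) : nat :=
  (if c < la l then a else 0) + (if c < mu l then b else 0).

Section TwoLayer.
Variables (a b : nat) (la mu : nat -> nat).
Hypotheses (a_gt0 : 0 < a) (b_gt0 : 0 < b) (la_decr : weakly_decreasing la)
  (mu_decr : weakly_decreasing mu) (la_le_mu : forall l, la l <= mu l).

Lemma two_layer_decreasing : decreasing_array (two_layer a b la mu).
Proof.
move=> l c; rewrite /two_layer; have := la_decr (leqnSn l); have := mu_decr (leqnSn l).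
by split; do ![case: ifP]; lia.
Qed.

Lemma two_layer_gt0 l c : (0 < two_layer a b la mu l c) = (c < mu l).
Proof. by rewrite /two_layer; have := la_le_mu l; do ![case: ifP]; lia. Qed.

Lemma two_layer_gt l c : (b < two_layer a b la mu l c) = (c < la l).
Proof. by rewrite /two_layer; have := la_le_mu l; do ![case: ifP]; lia. Qed.

Lemma two_layer_clash :
  (forall l c, ~~ clash_cell (two_layer a b la mu) l c) <->
  thin empty_shape la /\ thin la mu.
Proof.
split=> [no_clash|[la_thin mu_thin] l c].
  split=> l; rewrite leqNgt; apply/negP => fat.
    move: (no_clash l.+1 0); have := la_decr (leqnSn l); have := mu_decr (leqnSn l).
    have := la_le_mu l.+1; move: fat.
    rewrite /clash_cell /repeats_right /repeats_above /two_layer /empty_shape /=.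
    by do ![case: ifP]; lia.
  move: (no_clash l.+1 (la l)); have := la_decr (leqnSn l); have := mu_decr (leqnSn l).
  rewrite /clash_cell /repeats_right /repeats_above /two_layer /=; move: fat.
  by do ![case: ifP]; lia.
rewrite /clash_cell /repeats_right /repeats_above /two_layer; case: l => [|l] /=.
  by rewrite !andbF.
have := la_thin l; have := mu_thin l; rewrite /empty_shape.
by have := la_le_mu l; have := la_le_mu l.+1; do ![case: ifP]; lia.
Qed.

Lemma two_layer_free l c :
  free_cell (two_layer a b la mu) l c =
  ((c.+1 == la l) && ribbon_start empty_shape la l)
  || ((c.+1 == mu l) && ribbon_start la mu l).
Proof.
rewrite ribbon_start_empty /ribbon_start /free_cell /repeats_right /repeats_above.
rewrite /two_layer; case: l => [|l] /=.
  by have := la_le_mu 0; do ![case: ifP]; lia.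
have := la_decr (leqnSn l); have := mu_decr (leqnSn l).
by have := la_le_mu l; have := la_le_mu l.+1; do ![case: ifP]; lia.
Qed.

End TwoLayer.

(* The shape obtained from [la] by adding a ribbon of [s] cells in rows [i] to [j]:
   below row [i], connectedness without a 2 x 2 square forces row [l] to reach
   exactly one cell beyond [la l.-1], and [s] then determines the length of row [i]. *)
Definition add_ribbon (la : nat -> nat) (s i j l : nat) : nat :=
  if l < i then la l else if l == i then s + la j + i - j else
  if l <= j then (la l.-1).+1 else la l.

(* The length [s + la j + i - j] of row [i] lies in the interval from
   [(la i).+1] to [la i.-1]; stated without truncated subtraction. *)
Definition ribbon_fits (la : nat -> nat) (s i j : nat) : bool :=
  (la i + j < s + la j + i) && ((i == 0) || (s + la j + i <= la i.-1 + j)).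

Section AddRibbon.
Variables (la : nat -> nat) (s i j : nat).
Hypotheses (la_decr : weakly_decreasing la) (fits : ribbon_fits la s i j).

Let mu := add_ribbon la s i j.

Lemma ribbon_fits_leq : i <= j.
Proof.
rewrite leqNgt; apply/negP => lt_ji; case/andP: fits => _.
have : la i.-1 <= la j by apply: la_decr; lia.
by lia.
Qed.

Lemma add_ribbon_top : mu i = s + la j + i - j.
Proof. by rewrite /mu /add_ribbon ltnn eqxx. Qed.

Lemma add_ribbon_ge l : la l <= mu l.
Proof.
have := la_decr (leq_pred l); case/andP: fits; rewrite /mu /add_ribbon.
by case: (ltngtP l i) => [|_|->] //; [case: ifP|]; lia.
Qed.

Lemma add_ribbon_nonempty l : (la l < mu l) = (i <= l <= j).
Proof.
have := la_decr (leq_pred l); case/andP: fits; have := ribbon_fits_leq.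
by rewrite /mu /add_ribbon; case: (ltngtP l i) => [|_|->] //; [|case: ifP|]; lia.
Qed.

Lemma add_ribbon_thin : thin la mu.
Proof.
move=> l; have := la_decr (leqnSn l); case/andP: fits; rewrite /mu /add_ribbon /=.
by case: (ltngtP l.+1 i) => [|_|<-] //=; [|case: ifP|]; lia.
Qed.

Lemma add_ribbon_start l : ribbon_start la mu l = (l == i).
Proof.
have := la_decr (leq_pred l); case/andP: fits.
rewrite /ribbon_start /mu /add_ribbon.
by case: (ltngtP l i) => [|lt_il|->] //=; [|case: ifP|]; lia.
Qed.

Lemma add_ribbon_decr : weakly_decreasing mu.
Proof.
apply: weakly_decreasingS => l.
have := la_decr (leqnSn l); have := la_decr (leq_pred l); case/andP: fits.
rewrite /mu /add_ribbon /=; case: (ltngtP l i) => [lt_li|lt_il|->].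
- by case: (ltngtP l.+1 i) => [||<-] //=; lia.
- by do ![case: ifP]; lia.
- by do ![case: ifP]; lia.
Qed.

Lemma add_ribbon_out k l : j < k -> (forall l', k <= l' -> la l' = 0) ->
  k <= l -> mu l = 0.
Proof.
move=> lt_jk la_out le_kl; have := add_ribbon_nonempty l.
by rewrite la_out //; lia.
Qed.

Lemma sum_add_ribbon n : j < n -> \sum_(l < n) mu l = \sum_(l < n) la l + s.
Proof.
move=> lt_jn; have le_ij := ribbon_fits_leq; case/andP: fits => i_lt i_le.
have partial m : \sum_(0 <= l < m) mu l + (if m <= i then 0 else la (minn m.-1 j)) =
    \sum_(0 <= l < m) la l + (if m <= i then 0 else s + la j + minn m.-1 j - j).
  elim: m => [|m IH]; first by rewrite !big_geq.
  rewrite !big_nat_recr //= -[mu m]/(add_ribbon la s i j m) /add_ribbon; move: IH.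
  have := @la_decr m.-1 m; have := la_decr le_ij.
  case: (ltngtP m i) => [lt_mi|lt_im|->].
  - by lia.
  - have [le_mj|lt_jm] := leqP m j.
      have -> : minn m.-1 j = m.-1 by lia.
      by lia.
    have -> : minn m.-1 j = j by lia.
    by lia.
  - have -> : minn i j = i by lia.
    by lia.
rewrite -(big_mkord xpredT mu) -(big_mkord xpredT la).
have := partial n; have -> : minn n.-1 j = j by lia.
by have := la_decr le_ij; case: ifP; lia.
Qed.

End AddRibbon.

Lemma add_ribbon_inj la s i j s' i' j' :
  weakly_decreasing la -> ribbon_fits la s i j -> ribbon_fits la s' i' j' ->
  add_ribbon la s i j =1 add_ribbon la s' i' j' -> [/\ s = s', i = i' & j = j'].
Proof.
move=> la_decr fits fits' eq_mu.
have le_ij := ribbon_fits_leq la_decr fits.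
have le_ij' := ribbon_fits_leq la_decr fits'.
have rows l : (i <= l <= j) = (i' <= l <= j').
  by rewrite -(add_ribbon_nonempty la_decr fits) eq_mu add_ribbon_nonempty.
have ii' : i = i' by have := rows i; have := rows i'; lia.
have jj' : j = j' by have := rows j; have := rows j'; lia.
have := eq_mu i; subst i' j'; rewrite !add_ribbon_top.
by case/andP: fits; case/andP: fits'; split=> //; lia.
Qed.

Section RibbonShape.
Variables (k i : nat) (la mu : nat -> nat).
Hypotheses (la_decr : weakly_decreasing la) (mu_decr : weakly_decreasing mu)
  (la_le_mu : forall l, la l <= mu l) (la_mu_thin : thin la mu)
  (mu_out : forall l, k <= l -> mu l = 0) (i_start : ribbon_start la mu i)
  (start_uniq : forall l, ribbon_start la mu l -> l = i).

Let prev_nonempty l : l.+1 != i -> la l.+1 < mu l.+1 -> la l < mu l.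
Proof.
move=> /negP neq ne; have [le|lt] := leqP (mu l.+1) (la l).
  by case: neq; apply/eqP/start_uniq; rewrite /ribbon_start ne.
by apply: leq_trans lt _; apply: mu_decr.
Qed.

Let nonempty_ge l : la l < mu l -> i <= l.
Proof.
elim: l => [|l IH] ne.
  by rewrite -(@start_uniq 0) // /ribbon_start ne.
case: (l.+1 =P i) => [->//|/eqP neq].
by rewrite (leq_trans (IH (prev_nonempty neq ne))).
Qed.

Lemma add_ribbon_of_start : exists j s,
  [/\ j < k, ribbon_fits la s i j & mu =1 add_ribbon la s i j].
Proof.
have /andP[i_ne i_le] := i_start.
have ne_lt l : la l < mu l -> l < k by case: (ltnP l k) => // /mu_out ->.
have [j j_ne j_max] := ex_maxnP (ex_intro _ i i_ne) (fun l ne => ltnW (ne_lt l ne)).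
have le_ij : i <= j := nonempty_ge j_ne.
have mid_ne d : i + d <= j -> la (j - d) < mu (j - d).
  elim: d => [|d IH] le_j; first by rewrite subn0.
  have jd : (j - d.+1).+1 = j - d by lia.
  by apply: prev_nonempty; rewrite jd; [lia|apply: IH; lia].
have mid_row l : i < l <= j -> mu l = (la l.-1).+1.
  case/andP=> lt_il le_lj.
  have ne : la l < mu l by have := mid_ne (j - l); rewrite subKn //; apply; lia.
  have := la_mu_thin l.-1; rewrite prednK; last lia.
  have := @start_uniq l; rewrite /ribbon_start ne.
  by case: leqP => [_ /=|]; [rewrite orbT => /(_ isT)|]; lia.
have out_row l : ~~ (i <= l <= j) -> mu l = la l.
  move=> out; have := la_le_mu l; rewrite leq_eqVlt => /orP[/eqP->//|ne].
  by have := j_max l ne; have := nonempty_ge ne; lia.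
have := la_decr le_ij; exists j, (mu i + j - i - la j); split.
- exact: ne_lt.
- by apply/andP; split; lia.
- move=> l; rewrite /add_ribbon; case: (ltngtP l i) => [lt_li|lt_il|->]; last lia.
    by rewrite out_row //; lia.
  by case: leqP => lj; [rewrite mid_row|rewrite out_row]; lia.
Qed.

End RibbonShape.

Definition within (n : nat) (la : nat -> nat) : Prop :=
  forall l, 0 < la l -> la l + l <= n.

Lemma add_ribbon_within n la s i j :
  weakly_decreasing la -> ribbon_fits la s i j -> within n la ->
  within (n + s) (add_ribbon la s i j).
Proof.
move=> la_decr fits la_n l; have le_ij := ribbon_fits_leq la_decr fits.
have := la_n l; have := la_n l.-1; have := la_n i.-1; have := la_n j.
have := la_decr _ _ le_ij; case/andP: fits; rewrite /add_ribbon.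
by case: (ltngtP l i) => [|lt_il|->]; [|case: ifP|]; lia.
Qed.

Section TwoLayerFilling.
Variables (n a b : nat) (la mu : nat -> nat).
Hypotheses (a_gt0 : 0 < a) (b_gt0 : 0 < b) (la_decr : weakly_decreasing la)
  (mu_decr : weakly_decreasing mu) (la_le_mu : forall l, la l <= mu l).

Lemma sum_two_layer : (forall l, mu l <= n) ->
  \sum_(l < n) \sum_(c < n) two_layer a b la mu l c =
  a * (\sum_(l < n) la l) + b * (\sum_(l < n) mu l).
Proof.
move=> mu_le; rewrite !big_distrr -big_split /=; apply: eq_bigr => l _.
rewrite big_split /= !sum_if_ltn (minn_idPl (mu_le l)).
by rewrite (minn_idPl (leq_trans (la_le_mu l) (mu_le l))).
Qed.

Lemma card_two_layer_free : (forall l, mu l <= n) ->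
  #|[set c : 'I_n * 'I_n | free_cell (two_layer a b la mu) c.1 c.2]| =
  \sum_(l < n) ribbon_start empty_shape la l + \sum_(l < n) ribbon_start la mu l.
Proof.
move=> mu_le; pose last_cell (l c : 'I_n) : nat :=
  (c.+1 == la l) * ribbon_start empty_shape la l
  + (c.+1 == mu l) * ribbon_start la mu l.
transitivity (\sum_(p : 'I_n * 'I_n) last_cell p.1 p.2).
  rewrite -sum1_card big_mkcond; apply: eq_bigr => -[l c] _.
  rewrite inE two_layer_free // /last_cell /=.
  have : ribbon_start la mu l -> la l < mu l by case/andP.
  case: (ribbon_start empty_shape la l) (ribbon_start la mu l) => [] [];
    by case: ifP; lia.
have sum_last w : 0 < w <= n -> \sum_(c < n) (c.+1 == w : nat) = 1.
  move=> w_range; transitivity (\sum_(c < n) (c == w.-1 :> nat : nat)).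
    by apply: eq_bigr => c _; lia.
  by rewrite sum_eq_ord; lia.
rewrite -(pair_bigA _ last_cell) -big_split; apply: eq_bigr => l _ /=.
rewrite big_split /= -!big_distrl /=; congr (_ + _).
  case: (boolP (ribbon_start _ _ _)) => [/andP[la_gt0 _]|]; rewrite ?muln0 ?muln1 //.
  by rewrite sum_last // la_gt0 (leq_trans (la_le_mu l)).
case: (boolP (ribbon_start _ _ _)) => [/andP[mu_gt _]|]; rewrite ?muln0 ?muln1 //.
by rewrite sum_last // mu_le (leq_ltn_trans _ mu_gt).
Qed.

End TwoLayerFilling.

Definition tabulate n (f : nat -> nat -> nat) : filling n :=
  [ffun c : 'I_n * 'I_n => inord (f c.1 c.2)].

Lemma part_tabulate n f :
  (forall i j, n <= i \/ n <= j -> f i j = 0) ->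
  \sum_(i < n) \sum_(j < n) f i j = n -> part (tabulate n f) =2 f.
Proof.
move=> f_out f_sum i j.
have [i_lt|i_ge] := ltnP i n; last by rewrite part_row_out // f_out //; left.
have [j_lt|j_ge] := ltnP j n; last by rewrite part_col_out // f_out //; right.
rewrite -[i]/(Ordinal i_lt : nat) -[j]/(Ordinal j_lt : nat) part_ord ffunE inordK //=.
rewrite ltnS -[leqRHS]f_sum (bigD1 (Ordinal i_lt)) //= (bigD1 (Ordinal j_lt)) //=.
by rewrite -addnA leq_addr.
Qed.

Lemma tabulate_part n (e : filling n) f : part e =2 f -> e = tabulate n f.
Proof.
by move=> eE; apply/ffunP => -[i j]; rewrite ffunE -eE part_ord inord_val.
Qed.

Section TabulateTwoLayer.
Variables (k n a b : nat) (la mu : nat -> nat).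
Hypotheses (a_gt0 : 0 < a) (b_gt0 : 0 < b) (la_decr : weakly_decreasing la)
  (mu_decr : weakly_decreasing mu) (la_le_mu : forall l, la l <= mu l)
  (mu_n : within n mu)
  (sum_n : a * (\sum_(l < n) la l) + b * (\sum_(l < n) mu l) = n).

Let mu_le l : mu l <= n.
Proof. by have := @mu_n l; case: (mu l) => // w /(_ isT); lia. Qed.

Lemma part_two_layer : part (tabulate n (two_layer a b la mu)) =2 two_layer a b la mu.
Proof.
apply: part_tabulate; last by rewrite sum_two_layer.
move=> l c out; apply/eqP; rewrite -leqn0 leqNgt two_layer_gt0 // -leqNgt.
by case: out => out; have := @mu_n l; have := mu_le l; case: (mu l) => //; lia.
Qed.

Lemma two_layer_with_free_cells : (forall l, k <= l -> mu l = 0) ->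
  thin empty_shape la -> thin la mu ->
  tabulate n (two_layer a b la mu) \in with_free_cells k n
    (\sum_(l < n) ribbon_start empty_shape la l + \sum_(l < n) ribbon_start la mu l).
Proof.
move=> mu_out la_thin mu_thin; have partE := part_two_layer.
rewrite inE; apply/and3P; split.
- apply/plane_fillingP; split.
  + by move=> i j; rewrite !partE; apply: two_layer_decreasing.
  + move=> i j le_ki; apply/eqP; rewrite partE -leqn0 leqNgt two_layer_gt0 //.
    by rewrite mu_out.
  + by under eq_bigr do under eq_bigr do rewrite partE; rewrite sum_two_layer.
- apply/forallP => c; rewrite (clash_cell_ext _ _ partE).
  by move: c.1 c.2; apply/two_layer_clash.
- apply/eqP; rewrite -(@card_two_layer_free n a b) //.
  by apply: eq_card => c; rewrite !inE (free_cell_ext _ _ partE).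
Qed.

End TabulateTwoLayer.

Lemma two_layer_inj a b la mu a' b' la' mu' :
  0 < a -> 0 < b -> (forall l, la l <= mu l) -> (exists l, la l < mu l) ->
  0 < a' -> 0 < b' -> (forall l, la' l <= mu' l) -> (exists l, la' l < mu' l) ->
  two_layer a b la mu =2 two_layer a' b' la' mu' ->
  [/\ b = b', la =1 la', mu =1 mu' & (0 < la 0 -> a = a')].
Proof.
move=> a_gt0 b_gt0 la_le [l l_ne] a'_gt0 b'_gt0 la'_le [l' l'_ne] eq_f.
have mu_eq : mu =1 mu'.
  move=> i; apply: ltn_ext => c.
  by rewrite -(@two_layer_gt0 a b la mu) // eq_f two_layer_gt0.
have b_eq : b = b'.
  have := eq_f l (la l); have := eq_f l' (la' l').
  by rewrite /two_layer -!mu_eq; move: l_ne l'_ne; rewrite -mu_eq; do ![case: ifP]; lia.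
have la_eq : la =1 la'.
  move=> i; apply: ltn_ext => c.
  by rewrite -(@two_layer_gt a b la mu) // eq_f b_eq two_layer_gt.
split=> // la0; have := eq_f 0 0.
by rewrite /two_layer -la_eq -mu_eq la0 (leq_trans la0) // b_eq; lia.
Qed.

(** * Fillings with one or two free cells *)

Definition hook (s j : nat) : nat -> nat := add_ribbon empty_shape s 0 j.

Lemma hook_fits s j : ribbon_fits empty_shape s 0 j = (j < s).
Proof. by rewrite /ribbon_fits /empty_shape; lia. Qed.

Lemma empty_shape_decr : weakly_decreasing empty_shape.
Proof. by []. Qed.

Section Hook.
Variables (s j : nat).
Hypothesis lt_js : j < s.

Let fits : ribbon_fits empty_shape s 0 j.
Proof. by rewrite hook_fits. Qed.

Lemma hook_decr : weakly_decreasing (hook s j).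
Proof. exact: add_ribbon_decr empty_shape_decr fits. Qed.

Lemma hook0_gt0 : 0 < hook s j 0.
Proof. by rewrite /hook /add_ribbon /empty_shape /=; lia. Qed.

Lemma hook_within : within s (hook s j).
Proof. by apply: (@add_ribbon_within 0 _ s) fits _. Qed.

Lemma hook_thin : thin empty_shape (hook s j).
Proof. exact: add_ribbon_thin empty_shape_decr fits. Qed.

Lemma hook_start l : ribbon_start empty_shape (hook s j) l = (l == 0).
Proof. exact: add_ribbon_start empty_shape_decr fits l. Qed.

Lemma hook_out k l : j < k -> k <= l -> hook s j l = 0.
Proof. by move=> lt_jk; apply: (add_ribbon_out empty_shape_decr fits lt_jk). Qed.

Lemma sum_hook n : j < n -> \sum_(l < n) hook s j l = s.
Proof.
by move=> /(sum_add_ribbon empty_shape_decr fits) ->; rewrite big1.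
Qed.

Lemma add_ribbon_hook_lt s2 i j2 : ribbon_fits (hook s j) s2 i j2 -> j2 < s + s2.
Proof.
move=> fits2; have := add_ribbon_within hook_decr fits2 hook_within (l := j2).
have := add_ribbon_nonempty hook_decr fits2 j2.
by rewrite leqnn (ribbon_fits_leq hook_decr fits2); lia.
Qed.

End Hook.

Notation hook_code k n := ('I_n.+1 * 'I_n.+1 * 'I_k)%type.

(* The value of the entries, and the size and the last row of the hook. *)
Definition hook_codes (k n : nat) : {set hook_code k n} :=
  [set t : hook_code k n | (t.1.1 * t.1.2 == n) && (t.2 < t.1.2)].

Definition hook_filling k n (t : hook_code k n) : filling n :=
  tabulate n (two_layer 1 t.1.1 empty_shape (hook t.1.2 t.2)).

Section HookFilling.
Variables (k n : nat) (b s : 'I_n.+1) (j : 'I_k).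
Hypotheses (n_gt0 : 0 < n) (code : (b, s, j) \in hook_codes k n).

Lemma hook_codeP : [/\ 0 < b, j < s, s <= n & b * s = n].
Proof.
move: code; rewrite inE /= => /andP[/eqP bs lt_js]; split=> //.
  by rewrite lt0n; apply/eqP => b0; move: n_gt0; rewrite -bs b0.
by rewrite -ltnS.
Qed.

Lemma sum_hook_code :
  1 * (\sum_(l < n) empty_shape l) + b * (\sum_(l < n) hook s j l) = n.
Proof.
by have [_ lt_js le_sn bs] := hook_codeP; rewrite big1 // sum_hook //; lia.
Qed.

Lemma part_hook_filling :
  part (hook_filling (b, s, j)) =2 two_layer 1 b empty_shape (hook s j).
Proof.
have [b_gt0 lt_js le_sn bs] := hook_codeP.
apply: part_two_layer sum_hook_code => // l /(hook_within lt_js) /leq_trans-> //.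
Qed.

Lemma hook_filling_in : hook_filling (b, s, j) \in with_free_cells k n 1.
Proof.
have [b_gt0 lt_js le_sn bs] := hook_codeP.
rewrite (_ : 1 = \sum_(l < n) ribbon_start empty_shape empty_shape l
                 + \sum_(l < n) ribbon_start empty_shape (hook s j) l).
  apply: two_layer_with_free_cells sum_hook_code _ _ _ => //.
  - exact: hook_decr.
  - by move=> l /(hook_within lt_js) /leq_trans->.
  - by move=> l; apply: hook_out.
  - exact: hook_thin.
rewrite big1 // add0n; under eq_bigr do rewrite hook_start //.
by rewrite sum_eq_ord n_gt0.
Qed.

End HookFilling.

Lemma hook_filling_inj k n :
  0 < n -> {in hook_codes k n &, injective (@hook_filling k n)}.
Proof.
move=> n_gt0 [[b s] j] [[b' s'] j'] code code' eq_e.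
have [b_gt0 lt_js _ _] := hook_codeP n_gt0 code.
have [b'_gt0 lt_js' _ _] := hook_codeP n_gt0 code'.
have ne t i : i < t -> exists l, empty_shape l < hook t i l.
  by exists 0; apply: hook0_gt0.
have eq_f : two_layer 1 b empty_shape (hook s j)
    =2 two_layer 1 b' empty_shape (hook s' j').
  by move=> l c; rewrite -!part_hook_filling // eq_e.
have [b_eq _ hook_eq _] := two_layer_inj (ltn0Sn 0) b_gt0 (fun=> leq0n _) (ne _ _ lt_js)
  (ltn0Sn 0) b'_gt0 (fun=> leq0n _) (ne _ _ lt_js') eq_f.
have [s_eq _ j_eq] := add_ribbon_inj empty_shape_decr
  (etrans (hook_fits s j) lt_js) (etrans (hook_fits s' j') lt_js') hook_eq.
by congr (_, _, _); apply: val_inj.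
Qed.

Lemma level_shape n f v :
  0 < v -> decreasing_array f -> (forall i j, n <= j -> f i j = 0) ->
  exists2 la, weakly_decreasing la & forall l c, (v <= f l c) = (c < la l).
Proof.
move=> v_gt0 f_decr f_cols.
have small l : exists c, f l c < v by exists n; rewrite f_cols.
exists (fun l => ex_minn (small l)) => [l l' le_ll'|l c].
  case: ex_minnP => w' _ min_w'; case: ex_minnP => w small_w _.
  by apply: min_w'; apply: leq_ltn_trans small_w; apply: decreasing_array_col.
case: ex_minnP => w small_w min_w; rewrite [RHS]ltnNge [LHS]leqNgt; congr (~~ _).
apply/idP/idP => [|le_wc]; first exact: min_w.
by apply: leq_ltn_trans small_w; apply: decreasing_array_row.
Qed.

Lemma hook_of_thin k mu :
  weakly_decreasing mu -> thin empty_shape mu -> 0 < mu 0 ->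
  (forall l, k <= l -> mu l = 0) ->
  exists j s, [/\ j < k, j < s & mu =1 hook s j].
Proof.
move=> mu_decr mu_thin mu0 mu_out.
have start : ribbon_start empty_shape mu 0 by rewrite ribbon_start_empty.
have [|j [s [lt_jk]]] := add_ribbon_of_start empty_shape_decr mu_decr (fun=> leq0n _)
  mu_thin mu_out start.
  by move=> l; rewrite ribbon_start_empty => /andP[/eqP].
by rewrite hook_fits => lt_js muE; exists j, s.
Qed.

Lemma clash_freeP n (e : filling n) i j : clash_free e -> ~~ clash_cell (part e) i j.
Proof.
move=> /forallP no_clash; apply/negP => clash.
have /andP[i_lt j_lt] : (i < n) && (j < n).
  by apply: (@part_gt0_lt _ e); case/andP: clash => /andP[].
by have := no_clash (Ordinal i_lt, Ordinal j_lt); rewrite /= clash.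
Qed.

Section Structure.
Variables (k n : nat) (e : filling n).
Hypotheses (n_gt0 : 0 < n) (e_ok : plane_filling k e) (e_cf : clash_free e).

Let e_decr : decreasing_array (part e).
Proof. by case/plane_fillingP: e_ok. Qed.

Let e_rows i j : k <= i -> part e i j = 0.
Proof. by case/plane_fillingP: e_ok => _ + _; apply. Qed.

Let level_out v la l :
  0 < v -> (forall l c, (v <= part e l c) = (c < la l)) -> k <= l -> la l = 0.
Proof.
move=> v_gt0 laE le_kl; apply/eqP; rewrite -leqn0 leqNgt -laE e_rows //.
by rewrite leqn0 -lt0n.
Qed.

Lemma one_value_hook :
  (forall l c, part e l c = part e 0 0 \/ part e l c = 0) ->
  exists j s, [/\ j < k, j < s
    & part e =2 two_layer 1 (part e 0 0) empty_shape (hook s j)].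
Proof.
have v_gt0 := plane_filling_part00_gt0 n_gt0 e_ok.
set v := part e 0 0 in v_gt0 * => values.
have [mu mu_decr muE] := level_shape v_gt0 e_decr (@part_col_out n e).
have eE : part e =2 two_layer 1 v empty_shape mu.
  move=> l c; rewrite /two_layer /empty_shape ltn0 add0n -muE.
  by case: (values l c) => ->; [rewrite leqnn|rewrite leqNgt v_gt0].
have [_ mu_thin] : thin empty_shape empty_shape /\ thin empty_shape mu.
  apply/(two_layer_clash (ltn0Sn 0) v_gt0 empty_shape_decr mu_decr) => // l c.
  by rewrite -(clash_cell_ext _ _ eE) clash_freeP.
have mu0 : 0 < mu 0 by rewrite -muE.
have [j [s [lt_jk lt_js mu_hook]]] :=
  hook_of_thin mu_decr mu_thin mu0 (fun l => level_out v_gt0 muE).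
exists j, s; split=> // l c.
by rewrite eE /two_layer mu_hook.
Qed.

Lemma two_values_hook_ribbon (y : 'I_n * 'I_n) :
  let v1 := part e 0 0 in let v2 := part e y.1 y.2 in
  0 < v2 < v1 -> y \in free_cells e ->
  (forall l c, [\/ part e l c = v1, part e l c = v2 | part e l c = 0]) ->
  (forall x, x \in free_cells e -> part e x.1 x.2 = v2 -> x = y) ->
  exists j1 s1 i j s2, [/\ j1 < k, j1 < s1, j < k, ribbon_fits (hook s1 j1) s2 i j
    & part e =2 two_layer (v1 - v2) v2 (hook s1 j1) (add_ribbon (hook s1 j1) s2 i j)].
Proof.
move=> v1 v2 /andP[v2_gt0 lt_v21] y_free values y_uniq.
have v1_gt0 : 0 < v1 := ltn_trans v2_gt0 lt_v21.
have a_gt0 : 0 < v1 - v2 by rewrite subn_gt0.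
have [la la_decr laE] := level_shape v1_gt0 e_decr (@part_col_out n e).
have [mu mu_decr muE] := level_shape v2_gt0 e_decr (@part_col_out n e).
have la_le_mu l : la l <= mu l.
  rewrite leqNgt -laE; apply/negP => le_v1; have := muE l (mu l).
  by rewrite ltnn (leq_trans (ltnW lt_v21) le_v1).
have eE : part e =2 two_layer (v1 - v2) v2 la mu.
  move=> l c; rewrite /two_layer -laE -muE.
  by case: (values l c) => ->; do ![case: ifP]; lia.
have [la_thin mu_thin] : thin empty_shape la /\ thin la mu.
  apply/(two_layer_clash a_gt0 v2_gt0 la_decr mu_decr la_le_mu) => l c.
  by rewrite -(clash_cell_ext _ _ eE) clash_freeP.
have la0 : 0 < la 0 by rewrite -laE.
have [j1 [s1 [lt_j1k lt_j1s la_hook]]] :=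
  hook_of_thin la_decr la_thin la0 (fun l => level_out v1_gt0 laE).
have freeE := two_layer_free a_gt0 v2_gt0 la_decr mu_decr la_le_mu.
have y_start : ribbon_start la mu y.1.
  move: y_free; rewrite inE (free_cell_ext _ _ eE) freeE.
  case/orP=> /andP[/eqP y_end] //.
  by have := laE y.1 y.2; rewrite -y_end ltnSn leqNgt lt_v21.
have start_uniq l : ribbon_start la mu l -> l = y.1 :> nat.
  move=> l_start; have lt_la_mu : la l < mu l by case/andP: l_start.
  have l_free : free_cell (part e) l (mu l).-1.
    by rewrite (free_cell_ext _ _ eE) freeE l_start prednK ?eqxx ?orbT //; lia.
  have [x x_free [xl xc]] := mem_free_cells l_free.
  rewrite xl (y_uniq x x_free) // -xl -xc eE /two_layer.
  by do ![case: ifP]; lia.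
have [j [s2 [lt_jk]]] := add_ribbon_of_start la_decr mu_decr la_le_mu mu_thin
  (fun l => level_out v2_gt0 muE) y_start start_uniq.
have ribbonE l s i j' : add_ribbon la s i j' l = add_ribbon (hook s1 j1) s i j' l.
  by rewrite /add_ribbon !la_hook.
rewrite /ribbon_fits !la_hook => fits mu_ribbon.
exists j1, s1, y.1, j, s2; split=> // l c.
by rewrite eE /two_layer la_hook mu_ribbon ribbonE.
Qed.

End Structure.

Lemma two_layer_part k n (e : filling n) a b la mu :
  0 < a -> 0 < b -> (forall l, la l <= mu l) -> plane_filling k e ->
  part e =2 two_layer a b la mu ->
  a * (\sum_(l < n) la l) + b * (\sum_(l < n) mu l) = n
  /\ forall l, 0 < mu l -> l < n.
Proof.
move=> a_gt0 b_gt0 la_le_mu /plane_fillingP[_ _ e_sum] eE.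
have cell l c : c < mu l -> (l < n) && (c < n).
  by move=> lt_c; apply: (@part_gt0_lt _ e); rewrite eE two_layer_gt0.
split=> [|l /cell/andP[] //]; rewrite -sum_two_layer //.
  by rewrite -[RHS]e_sum; do 2!apply: eq_bigr => ? _; rewrite eE.
by move=> l; rewrite leqNgt; apply/negP => /cell; rewrite ltnn andbF.
Qed.

Lemma hook_filling_surj k n e : 0 < n -> e \in with_free_cells k n 1 ->
  exists2 t, t \in hook_codes k n & e = hook_filling t.
Proof.
move=> n_gt0; rewrite inE => /and3P[e_ok e_cf /cards1P[x free_x]].
have v_gt0 := plane_filling_part00_gt0 n_gt0 e_ok.
have in_x l c : 0 < part e l c -> part e l c = part e x.1 x.2.
  by case/(free_cells_of_value e_ok) => y; rewrite free_x inE => /eqP->.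
have [l c|j [s [lt_jk lt_js eE]]] := one_value_hook n_gt0 e_ok e_cf.
  case: (posnP (part e l c)) => [|lc_gt0]; [by right|left].
  by rewrite (in_x l c) // (in_x 0 0).
have [e_sum rows_lt] := two_layer_part (ltn0Sn 0) v_gt0 (fun=> leq0n _) e_ok eE.
have lt_jn : j < n.
  apply: rows_lt; have := add_ribbon_nonempty empty_shape_decr _ j.
  by move=> /(_ s 0 j); rewrite hook_fits leqnn => /(_ lt_js).
rewrite big1 // sum_hook // mul1n add0n in e_sum.
exists (inord (part e 0 0), inord s, Ordinal lt_jk).
  by rewrite inE /= !inordK ?e_sum ?eqxx //; nia.
by apply: tabulate_part => l c; rewrite eE /= !inordK //; nia.
Qed.

Lemma card_one_free_cell k n : 0 < n ->
  #|with_free_cells k n 1| = #|hook_codes k n|.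
Proof.
move=> n_gt0; rewrite -(card_in_imset (hook_filling_inj n_gt0)); apply: eq_card => e.
apply/idP/imsetP => [/(hook_filling_surj n_gt0)[t t_in ->]|[[[b s] j] t_in ->]].
  by exists t.
exact: hook_filling_in.
Qed.

Definition solutions (n x y : nat) : {set 'I_n.+1 * 'I_n.+1} :=
  [set u : 'I_n.+1 * 'I_n.+1 | [&& 0 < u.1, 0 < u.2 & u.1 * x + u.2 * y == n]].

(* A hook is coded by its last row, a ribbon added to it by its first and last rows. *)
Definition hook_ribbons (k s1 s2 : nat) : {set 'I_k * ('I_k * 'I_k)} :=
  [set q : 'I_k * ('I_k * 'I_k) |
     (q.1 < s1) && ribbon_fits (hook s1 q.1) s2 q.2.1 q.2.2].

Notation ribbon_code k n :=
  ('I_n.+1 * 'I_n.+1 * ('I_n.+1 * 'I_n.+1 * ('I_k * ('I_k * 'I_k))))%type.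

(* The sizes of the hook and of the ribbon, the values of the two layers, and the
   rows of the hook and of the ribbon. *)
Definition ribbon_codes (k n : nat) : {set ribbon_code k n} :=
  [set t : ribbon_code k n | (t.2.1 \in solutions n t.1.1 (t.1.1 + t.1.2))
                             && (t.2.2 \in hook_ribbons k t.1.1 t.1.2)].

Definition ribbon_filling k n (t : ribbon_code k n) : filling n :=
  let la := hook t.1.1 t.2.2.1 in
  tabulate n (two_layer t.2.1.1 t.2.1.2 la
                        (add_ribbon la t.1.2 t.2.2.2.1 t.2.2.2.2)).

Section RibbonFilling.
Variables (k n : nat) (s1 s2 a b : 'I_n.+1) (j1 i j : 'I_k).
Hypothesis code : (s1, s2, (a, b, (j1, (i, j)))) \in ribbon_codes k n.

Let la := hook s1 j1.
Let mu := add_ribbon la s2 i j.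

Lemma ribbon_codeP :
  [/\ 0 < a, 0 < b, a * s1 + b * (s1 + s2) = n, j1 < s1 & ribbon_fits la s2 i j].
Proof. by move: code; rewrite !inE /= => /andP[/and3P[? ? /eqP ?] /andP[]]. Qed.

Let code_size_le : s1 + s2 <= n.
Proof.
have [_ b_gt0 sum_n _ _] := ribbon_codeP.
by rewrite -[leqRHS]sum_n (leq_trans (leq_pmull _ b_gt0)) ?leq_addl.
Qed.

Let code_within : within n mu.
Proof.
have [_ _ _ lt_js1 fits] := ribbon_codeP => l.
move/(add_ribbon_within (hook_decr lt_js1) fits (hook_within lt_js1))/leq_trans.
exact.
Qed.

Let code_le l : la l <= mu l.
Proof.
by have [_ _ _ lt_js1 fits] := ribbon_codeP; apply/add_ribbon_ge/fits/hook_decr.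
Qed.

Let code_row_lt : j < n.
Proof.
have [_ _ _ lt_js1 fits] := ribbon_codeP.
exact: leq_trans (add_ribbon_hook_lt lt_js1 fits) code_size_le.
Qed.

Let code_sum : a * (\sum_(l < n) la l) + b * (\sum_(l < n) mu l) = n.
Proof.
have [_ _ sum_n lt_js1 fits] := ribbon_codeP; have la_decr := hook_decr lt_js1.
have lt_j1n : j1 < n by apply: leq_trans lt_js1 (leq_trans (leq_addr _ _) code_size_le).
by rewrite (sum_add_ribbon la_decr fits code_row_lt) sum_hook.
Qed.

Lemma part_ribbon_filling :
  part (ribbon_filling (s1, s2, (a, b, (j1, (i, j))))) =2 two_layer a b la mu.
Proof. by have [*] := ribbon_codeP; apply: part_two_layer. Qed.

Lemma ribbon_filling_in :
  ribbon_filling (s1, s2, (a, b, (j1, (i, j)))) \in with_free_cells k n 2.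
Proof.
have [a_gt0 b_gt0 sum_n lt_js1 fits] := ribbon_codeP.
have la_decr := hook_decr lt_js1.
have lt_in : i < n := leq_ltn_trans (ribbon_fits_leq la_decr fits) code_row_lt.
rewrite (_ : 2 = \sum_(l < n) ribbon_start empty_shape la l
                 + \sum_(l < n) ribbon_start la mu l).
  apply: two_layer_with_free_cells => //.
  - exact: add_ribbon_decr.
  - move=> l; apply: (add_ribbon_out la_decr fits (ltn_ord j)) => l'.
    exact: hook_out.
  - exact: hook_thin.
  - exact: add_ribbon_thin.
under eq_bigr do rewrite hook_start //.
under [X in _ + X]eq_bigr do rewrite add_ribbon_start //.
by rewrite !sum_eq_ord lt_in (leq_ltn_trans _ lt_in).
Qed.

End RibbonFilling.

Lemma ribbon_filling_inj k n : {in ribbon_codes k n &, injective (@ribbon_filling k n)}.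
Proof.
move=> [[s1 s2] [[a b] [j1 [i j]]]] [[s1' s2'] [[a' b'] [j1' [i' j']]]] code code' eq_e.
have [a_gt0 b_gt0 _ lt_js1 fits] := ribbon_codeP code.
have [a'_gt0 b'_gt0 _ lt_js1' fits'] := ribbon_codeP code'.
have la_decr := hook_decr lt_js1; have la'_decr := hook_decr lt_js1'.
have ne := add_ribbon_nonempty la_decr fits.
have ne' := add_ribbon_nonempty la'_decr fits'.
have eq_f l c := etrans (esym (part_ribbon_filling code l c))
  (etrans (congr1 (fun e => part e l c) eq_e) (part_ribbon_filling code' l c)).
have [||b_eq la_eq mu_eq a_eq] := two_layer_inj
  a_gt0 b_gt0 (add_ribbon_ge la_decr fits) _
  a'_gt0 b'_gt0 (add_ribbon_ge la'_decr fits') _ eq_f.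
- by exists i; rewrite ne leqnn (ribbon_fits_leq la_decr fits).
- by exists i'; rewrite ne' leqnn (ribbon_fits_leq la'_decr fits').
have [s1_eq _ j1_eq] := add_ribbon_inj empty_shape_decr
  (etrans (hook_fits s1 j1) lt_js1) (etrans (hook_fits s1' j1') lt_js1') la_eq.
have {}a_eq := a_eq (hook0_gt0 lt_js1).
rewrite -s1_eq -j1_eq in fits' mu_eq.
have [s2_eq i_eq j_eq] := add_ribbon_inj la_decr fits fits' mu_eq.
by congr (_, _, (_, _, (_, (_, _)))); apply: val_inj.
Qed.

Lemma two_free_values k n (e : filling n) :
  0 < n -> e \in with_free_cells k n 2 -> exists y : 'I_n * 'I_n,
  [/\ 0 < part e y.1 y.2 < part e 0 0, y \in free_cells e,
    forall l c,
      [\/ part e l c = part e 0 0, part e l c = part e y.1 y.2 | part e l c = 0]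
  & forall x, x \in free_cells e -> part e x.1 x.2 = part e y.1 y.2 -> x = y].
Proof.
move=> n_gt0; rewrite inE => /and3P[e_ok e_cf /eqP card2].
have v_gt0 := plane_filling_part00_gt0 n_gt0 e_ok.
have /plane_fillingP[e_decr _ _] := e_ok.
have [x x_free xE] := free_cells_of_value e_ok v_gt0.
have /cards1P[y free_y] : #|free_cells e :\ x| == 1.
  by move: card2; rewrite (cardsD1 x) x_free add1n => -[->].
have /setD1P[neq_yx y_free] : y \in free_cells e :\ x by rewrite free_y set11.
have freeE z : z \in free_cells e -> z = x \/ z = y.
  move=> z_free; case: (eqVneq z x) => [|neq_zx]; first by left.
  by right; apply/set1P; rewrite -free_y !inE neq_zx; rewrite inE in z_free.
have y_gt0 : 0 < part e y.1 y.2 by move: y_free; rewrite inE => /and3P[].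
have values l c :
    [\/ part e l c = part e 0 0, part e l c = part e y.1 y.2 | part e l c = 0].
  case: (posnP (part e l c)) => [->|]; first by constructor 3.
  case/(free_cells_of_value e_ok) => z /freeE[] -> ->; first by constructor 1.
  by constructor 2.
have neq_values : part e y.1 y.2 != part e 0 0.
  apply/eqP => y00; have [l c|j [s [_ lt_js eE]]] := one_value_hook n_gt0 e_ok e_cf.
    by case: (values l c); [left|rewrite y00; left|right].
  have corner z : z \in free_cells e -> z.1 = 0 :> nat /\ z.2.+1 = hook s j 0.
    rewrite inE (free_cell_ext _ _ eE) two_layer_free //; last exact: hook_decr.
    rewrite hook_start // ribbon_start_empty andbF /= => /andP[/eqP + /eqP z1].
    by rewrite z1.
  have [x1 x2] := corner x x_free; have [y1 y2] := corner y y_free.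
  case/eqP: neq_yx; rewrite [LHS]surjective_pairing [RHS]surjective_pairing.
  congr (_, _); apply: val_inj; first by rewrite /= y1 x1.
  by apply: succn_inj; rewrite /= y2 x2.
exists y; split=> //.
  by rewrite y_gt0 ltn_neqAle neq_values decreasing_array_le00.
by move=> z /freeE[] -> // zE; case/eqP: neq_values; rewrite -zE -xE.
Qed.

Lemma ribbon_filling_surj k n e : 0 < n -> e \in with_free_cells k n 2 ->
  exists2 t, t \in ribbon_codes k n & e = ribbon_filling t.
Proof.
move=> n_gt0 e_in; have [y [lt_v21 y_free values y_uniq]] := two_free_values n_gt0 e_in.
move: e_in; rewrite inE => /and3P[e_ok e_cf _].
have [j1 [s1 [i [j [s2 [lt_j1k lt_js1 lt_jk fits eE]]]]]] :=
  two_values_hook_ribbon n_gt0 e_ok e_cf lt_v21 y_free values y_uniq.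
move: (part e 0 0) (part e y.1 y.2) lt_v21 eE => v1 b /andP[b_gt0 lt_bv1].
have: 0 < v1 - b by rewrite subn_gt0.
move: (v1 - b) => a a_gt0 eE {v1 lt_bv1 values y_uniq}.
have la_decr := hook_decr lt_js1; have le_ij := ribbon_fits_leq la_decr fits.
have [e_sum rows_lt] := two_layer_part a_gt0 b_gt0 (add_ribbon_ge la_decr fits) e_ok eE.
have lt_jn : j < n.
  apply: rows_lt; have := add_ribbon_nonempty la_decr fits j.
  by rewrite le_ij leqnn; lia.
have lt_j1n : j1 < n.
  apply: rows_lt; apply: leq_trans (add_ribbon_ge la_decr fits j1).
  have := add_ribbon_nonempty empty_shape_decr (etrans (hook_fits s1 j1) lt_js1) j1.
  by rewrite leqnn.
rewrite sum_add_ribbon // sum_hook // in e_sum.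
have lt_ik : i < k := leq_ltn_trans le_ij lt_jk.
exists (inord s1, inord s2, (inord a, inord b,
          (Ordinal lt_j1k, (Ordinal lt_ik, Ordinal lt_jk)))).
  by rewrite !inE /= !inordK ?e_sum ?eqxx ?a_gt0 ?b_gt0 ?lt_js1 //; nia.
by apply: tabulate_part => l c; rewrite eE /= !inordK //; nia.
Qed.

Lemma card_two_free_cells k n : 0 < n ->
  #|with_free_cells k n 2| = #|ribbon_codes k n|.
Proof.
move=> n_gt0; rewrite -(card_in_imset (@ribbon_filling_inj k n)); apply: eq_card => e.
apply/idP/imsetP => [/(ribbon_filling_surj n_gt0)[t t_in ->]|].
  by exists t.
by case=> -[[s1 s2] [[a b] [j1 [i j]]]] t_in ->; apply: ribbon_filling_in.
Qed.

(** * Counting ribbons with beads *)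

(* The beads of a shape with at most [k] rows; adding a ribbon of [s] cells whose
   last row is [j] moves bead [j] up by [s], to an unoccupied place. *)
Definition bead (k : nat) (la : nat -> nat) (l : nat) : nat := la l + (k - l.+1).

Lemma sum_ribbon_fits k la s j : weakly_decreasing la -> j < k ->
  \sum_(i < k) ribbon_fits la s i j
  + \sum_(l < k) (bead k la l == bead k la j + s) = 1.
Proof.
move=> la_decr lt_jk; set t := bead k la j + s.
rewrite -(big_mkord xpredT (fun i => ribbon_fits la s i j : nat)).
rewrite -(big_mkord xpredT (fun l => bead k la l == t : nat)).
have partial m : m <= k -> \sum_(0 <= i < m) ribbon_fits la s i j
    + \sum_(0 <= l < m) (bead k la l == t) = (0 < m) && (bead k la m.-1 <= t).
  elim: m => [|m IH] le_mk; first by rewrite !big_geq.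
  rewrite !big_nat_recr //=; have := IH (ltnW le_mk); have := la_decr _ _ (leq_pred m).
  rewrite /ribbon_fits /t /bead; case: m {IH} le_mk => [|m] le_mk /=; lia.
rewrite partial // (leq_ltn_trans _ lt_jk) //=.
have := la_decr j k.-1; rewrite /t /bead; lia.
Qed.

Section HookBeads.
Variables (k s j : nat).
Hypotheses (lt_jk : j < k) (lt_js : j < s).

Let b := k - j.+1.

(* The beads of a hook are those of the empty shape, [0] to [k.-1], with [b] moved. *)
Lemma sum_hook_beads (F : nat -> nat) :
  \sum_(l < k) F (bead k (hook s j) l) + F b = F (b + s) + \sum_(c < k) F c.
Proof.
move: lt_jk; rewrite /b; case: (k) => // k' lt_jk'; rewrite big_ord_recl.
have -> : F (bead k'.+1 (hook s j) 0) = F (k'.+1 - j.+1 + s).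
  by congr (F _); rewrite /bead /hook /add_ribbon /empty_shape /=; lia.
rewrite -addnA; congr (_ + _); rewrite [RHS](reindex_inj rev_ord_inj) /=.
rewrite [RHS](bigD1_ord (Ordinal lt_jk')) //= addnC; congr (_ + _).
apply: eq_bigr => l _; congr (F _).
rewrite /bead /hook /add_ribbon /empty_shape /= /bump leq0n add1n.
by have := ltn_ord l; case: (leqP j l); lia.
Qed.

Lemma sum_hook_ribbon_fits s2 : 0 < s2 ->
  \sum_(j2 < k) \sum_(i < k) ribbon_fits (hook s j) s2 i j2
  + (k - s2) + (s2 <= b + s < k + s2)
  = k + (s2 <= b) + (s == s2) + (b + s2 < k).
Proof.
move=> s2_gt0; pose occupied (u : nat) := \sum_(l < k) (bead k (hook s j) l == u).
have occupiedE u : occupied u + (b == u) = (b + s == u) + (u < k).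
  by rewrite /occupied (sum_hook_beads (fun c => c == u : nat)) sum_eq_ord.
have sum_eq_shift (m : nat) : \sum_(c < k) (m == c + s2) = (s2 <= m < k + s2).
  transitivity (\sum_(c < k) (s2 <= m) * (c == m - s2 :> nat)).
    by apply: eq_bigr => c _; lia.
  by rewrite -big_distrr /= sum_eq_ord; lia.
have sum_occupied_shift : \sum_(c < k) occupied (c + s2) + (s2 <= b) =
    (s2 <= b + s < k + s2) + (k - s2).
  have -> : (s2 <= b) = (s2 <= b < k + s2) by rewrite /b; lia.
  rewrite -!sum_eq_shift -big_split /=; under eq_bigr do rewrite occupiedE.
  rewrite big_split /=; congr (_ + _).
  transitivity (\sum_(c < k) (c < k - s2)); last by rewrite sum_ltn; lia.
  by apply: eq_bigr => c _; lia.
have sum_fits : \sum_(j2 < k) \sum_(i < k) ribbon_fits (hook s j) s2 i j2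
    + \sum_(j2 < k) occupied (bead k (hook s j) j2 + s2) = k.
  rewrite -big_split /= -[RHS]card_ord -sum1_card; apply: eq_bigr => j2 _.
  by apply: sum_ribbon_fits => //; apply: hook_decr.
have [lt_bk le_kbs] : b < k /\ k <= b + s by rewrite /b; lia.
have occupied_b : occupied (b + s2) = (s == s2) + (b + s2 < k).
  by rewrite -(eqn_add2l b) -occupiedE; case: eqP => [|_]; lia.
have occupied_top : occupied (b + s + s2) = 0 by have := occupiedE (b + s + s2); lia.
have := sum_hook_beads (fun c => occupied (c + s2)).
rewrite occupied_b occupied_top; move: sum_occupied_shift sum_fits.
move: (\sum_(c < k) occupied _) (\sum_(c < k) occupied _) (\sum_(c < k) \sum_(i < k) _).
move: (nat_of_bool (s == s2)) (nat_of_bool (b + s2 < k)) (nat_of_bool (s2 <= b)).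
by move: (nat_of_bool (s2 <= b + s < k + s2)); lia.
Qed.

End HookBeads.

Lemma card_hook_ribbonsE k s1 s2 : #|hook_ribbons k s1 s2| =
  \sum_(j1 < k | j1 < s1) \sum_(j < k) \sum_(i < k) ribbon_fits (hook s1 j1) s2 i j.
Proof.
rewrite (card_dep_pair (fun j1 : 'I_k => j1 < s1)
  (fun j1 (q : 'I_k * 'I_k) => ribbon_fits (hook s1 j1) s2 q.1 q.2)).
apply: eq_bigr => j1 _; rewrite exchange_big cardsE -sum1_card big_mkcond /=.
rewrite (pair_bigA _ (fun i j : 'I_k => ribbon_fits (hook s1 j1) s2 i j : nat)).
by apply: eq_bigr => -[i j] _; rewrite unfold_in.
Qed.

Lemma card_hook_ribbons k s1 s2 : 0 < s2 -> let m := minn k s1 in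
  #|hook_ribbons k s1 s2| + m * (k - s2) + (minn (k + s1 - s2) m - (s1 - s2))
  = m * k + minn (k - s2) m + m * (s1 == s2) + (m - s2).
Proof.
move=> s2_gt0 m; rewrite card_hook_ribbonsE.
have narrow (F : nat -> nat) : \sum_(j < k | j < s1) F j = \sum_(j < m) F j.
  rewrite (big_ord_widen_cond k xpredT F) ?geq_minl //.
  by apply: eq_bigl => j /=; have := ltn_ord j; rewrite /m; lia.
rewrite (narrow (fun j1 => \sum_(j < k) \sum_(i < k) ribbon_fits (hook s1 j1) s2 i j)).
have sum_const c : \sum_(j < m) c = m * c by rewrite sum_nat_const card_ord.
have sum_interval lo hi : \sum_(j < m) (lo <= j < hi) = minn hi m - lo.
  transitivity (\sum_(j < m) (j < hi) - \sum_(j < m) (j < minn lo hi)).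
    rewrite -sumnB => [|j _]; last by lia.
    by apply: eq_bigr => j _; lia.
  by rewrite !sum_ltn; lia.
have -> : minn (k - s2) m = \sum_(j < m) (j < k - s2) by rewrite sum_ltn.
have -> : m - s2 = \sum_(j < m) (s2 <= j < m) by rewrite sum_interval minnn.
rewrite -!sum_const -sum_interval -!big_split /=; apply: eq_bigr => j1 _.
have /andP[lt_j1k lt_j1s] : (j1 < k) && (j1 < s1) by rewrite -leq_min ltn_ord.
have -> : (s1 - s2 <= j1 < k + s1 - s2) = (s2 <= k - j1.+1 + s1 < k + s2) by lia.
have -> : (j1 < k - s2) = (s2 <= k - j1.+1) by lia.
have -> : (s2 <= j1 < m) = (k - j1.+1 + s2 < k) by rewrite ltn_ord; lia.
exact: sum_hook_ribbon_fits.
Qed.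

Definition hook_ribbon_parity (k r s : nat) : bool :=
  [&& 0 < r, 0 < s &
    [&& odd (r + s), r < s + k, s < r + k & k < r + s]
    || [&& odd r, odd s, r != s, r < k & s < k]].

Lemma hook_ribbon_parity_gt k r s : r < s -> k < s ->
  hook_ribbon_parity k r s = [&& 0 < r, odd (r + s) & s < r + k].
Proof.
move=> lt_rs lt_ks; rewrite /hook_ribbon_parity [s < k]ltnNge (ltnW lt_ks) !andbF orbF.
have [-> ->] : (r < s + k) = true /\ (k < r + s) = true by lia.
by rewrite (leq_ltn_trans _ lt_rs) // andbT.
Qed.

Lemma hook_ribbon_parity_le k r s : ~~ odd k -> r < s -> s <= k ->
  hook_ribbon_parity k r s =
  (0 < r) && (if r + s <= k then odd r && odd s else odd r || odd s).
Proof.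
move=> even_k lt_rs le_sk.
rewrite /hook_ribbon_parity oddD ltn_eqF // (leq_ltn_trans _ lt_rs) //.
have -> : (r < s + k) = true by lia.
have -> : (r < k) = true by lia.
have [->|r_gt0] := posnP r; first by [].
have -> : (s < r + k) = true by lia.
rewrite [k < _]ltnNge /=; case: (leqP (r + s) k) => /= le_rsk.
  have -> : (s < k) = true by lia.
  by case: (odd r) (odd s) => [] [].
rewrite ltn_neqAle le_sk andbT; case: (eqVneq s k) => [->|_] /=.
  by rewrite (negbTE even_k); case: (odd r).
by case: (odd r) (odd s) => [] [].
Qed.

Lemma hook_ribbon_parityC k r s : hook_ribbon_parity k r s = hook_ribbon_parity k s r.
Proof.
rewrite /hook_ribbon_parity addnC eq_sym andbCA; congr [&& _, _ & _ || _].
  by rewrite [X in _ && X]andbCA.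
by rewrite andbCA [(r < k) && _]andbC.
Qed.

Lemma odd_card_hook_ribbons_minn k s1 s2 : ~~ odd k -> 0 < s2 -> let m := minn k s1 in
  odd #|hook_ribbons k s1 s2| (+) odd m && odd (k - s2)
  (+) odd (minn (k + s1 - s2) m - (s1 - s2))
  = odd (minn (k - s2) m) (+) odd m && (s1 == s2) (+) odd (m - s2).
Proof.
move=> /negbTE odd_k s2_gt0; have := congr1 odd (card_hook_ribbons k s1 s2_gt0).
by rewrite !oddD !oddM odd_k andbF oddb.
Qed.

Section OddCardHookRibbons.
Variables (k s1 s2 : nat).
Hypotheses (even_k : ~~ odd k) (s1_gt0 : 0 < s1) (s2_gt0 : 0 < s2).

Let odd_k : odd k = false := negbTE even_k.

Lemma odd_card_hook_ribbons_lt :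
  s1 < s2 -> odd #|hook_ribbons k s1 s2| = hook_ribbon_parity k s1 s2.
Proof.
move=> lt_s; have := odd_card_hook_ribbons_minn s1 even_k s2_gt0.
move: (odd #|_|) => b /=.
have -> : s1 - s2 = 0 by lia.
have -> : minn k s1 - s2 = 0 by lia.
rewrite subn0 [s1 == s2]ltn_eqF // andbF !addbF.
have [le_s2k|lt_ks2] := leqP s2 k.
  rewrite hook_ribbon_parity_le // s1_gt0 oddB // odd_k.
  have -> : minn k s1 = s1 by lia.
  have -> : minn (k + s1 - s2) s1 = s1 by lia.
  case: (leqP (s1 + s2) k) => le_S.
    have -> : minn (k - s2) s1 = s1 by lia.
    by case: b (odd s1) (odd s2) => [] [] [].
  have -> : minn (k - s2) s1 = k - s2 by lia.
  by rewrite oddB // odd_k; case: b (odd s1) (odd s2) => [] [] [].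
rewrite hook_ribbon_parity_gt // s1_gt0 oddD.
have -> : k - s2 = 0 by lia.
have -> : minn (k + s1 - s2) (minn k s1) = k + s1 - s2 by lia.
rewrite min0n andbF addbF [s1 + k]addnC; case: ltnP => lt_s2.
  rewrite oddB ?(ltnW lt_s2) // oddD odd_k andbT.
  by case: b (odd s1) (odd s2) => [] [] [].
have -> : k + s1 - s2 = 0 by lia.
by rewrite andbF addbF.
Qed.

Lemma odd_card_hook_ribbons_gt :
  s2 < s1 -> odd #|hook_ribbons k s1 s2| = hook_ribbon_parity k s1 s2.
Proof.
move=> lt_s; have := odd_card_hook_ribbons_minn s1 even_k s2_gt0.
move: (odd #|_|) => b /=.
rewrite hook_ribbon_parityC [s1 == s2]gtn_eqF // andbF addbF.
have [le_s1k|lt_ks1] := leqP s1 k.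
  have le_s2k := leq_trans (ltnW lt_s) le_s1k.
  rewrite hook_ribbon_parity_le // s2_gt0 oddB // odd_k.
  have -> : minn (k + s1 - s2) s1 - (s1 - s2) = s2 by lia.
  rewrite oddB ?(ltnW lt_s) // [s2 + s1]addnC; case: (leqP (s1 + s2) k) => le_S.
    have -> : minn (k - s2) s1 = s1 by lia.
    by case: b (odd s1) (odd s2) => [] [] [].
  have -> : minn (k - s2) s1 = k - s2 by lia.
  by rewrite oddB // odd_k; case: b (odd s1) (odd s2) => [] [] [].
rewrite hook_ribbon_parity_gt // s2_gt0 odd_k oddD.
have -> : minn (k + s1 - s2) k = k by lia.
have -> : minn (k - s2) k = k - s2 by lia.
rewrite addbb addbF; case: ltnP => lt_s1.
  rewrite oddB ?odd_k; last lia.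
  by rewrite oddB ?(ltnW lt_s) //; case: b (odd s1) (odd s2) => [] [] [].
have -> : k - (s1 - s2) = 0 by lia.
by rewrite andbF addbF.
Qed.

Lemma odd_card_hook_ribbons_eq : s1 = s2 -> ~~ odd #|hook_ribbons k s1 s2|.
Proof.
move=> eq_s; have := odd_card_hook_ribbons_minn s1 even_k s2_gt0.
rewrite -{}eq_s; move: (odd #|_|) => b /=.
rewrite subnn subn0 addnK eqxx andbT; have [le_s1k|lt_ks1] := leqP s1 k.
  have -> : minn k s1 = s1 by lia.
  rewrite subnn oddB // odd_k; case: (leqP s1 (k - s1)) => _.
    by case: b (odd s1) => [] [].
  by rewrite oddB // odd_k; case: b (odd s1) => [] [].
have -> : k - s1 = 0 by lia.
by rewrite min0n minnn odd_k; case: b.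
Qed.

End OddCardHookRibbons.

Lemma odd_card_hook_ribbons k s1 s2 : ~~ odd k ->
  odd #|hook_ribbons k s1 s2| = hook_ribbon_parity k s1 s2.
Proof.
move=> even_k; have [->|s1_gt0] := posnP s1; first by rewrite card_hook_ribbonsE big1.
have [->|s2_gt0] := posnP s2.
  rewrite hook_ribbon_parityC card_hook_ribbonsE big1 // => j1 lt_j1.
  rewrite big1 // => j _; rewrite big1 // => i _.
  apply/eqP; rewrite eqb0; apply/negP => fits.
  have le_ij := ribbon_fits_leq (hook_decr lt_j1) fits.
  by have := hook_decr lt_j1 le_ij; case/andP: fits; lia.
have [lt_s|lt_s|eq_s] := ltngtP s1 s2.
- exact: odd_card_hook_ribbons_lt.
- exact: odd_card_hook_ribbons_gt.
- rewrite (negbTE (odd_card_hook_ribbons_eq even_k s1_gt0 s2_gt0 eq_s)) eq_s.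
  by rewrite /hook_ribbon_parity oddD addbb eqxx !andbF.
Qed.

(** * Solutions of a x + b y = n *)

Lemma sum_affine_eq n x c lo : 0 < x ->
  \sum_(a < n.+1) ((lo < a) && (a * x + c == n) : nat)
  = (lo * x + c < n) && (x %| n - c).
Proof.
move=> x_gt0; have solve (a : nat) : (lo < a) && (a * x + c == n) =
    (a == (n - c) %/ x) && ((lo * x + c < n) && (x %| n - c)).
  apply/andP/andP => [[lt_lo /eqP <-]|[/eqP-> /andP[lt_n x_dvd]]].
    by rewrite addnK mulnK // eqxx dvdn_mull // andbT ltn_add2r ltn_pmul2r.
  by rewrite -(ltn_pmul2r x_gt0) divnK //; split; lia.
under eq_bigr do rewrite solve -mulnb.
rewrite -big_distrl /= sum_eq_ord ltnS (leq_trans (leq_div _ _)) ?leq_subr //.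
by rewrite mul1n.
Qed.

Lemma sum_muln_eq n x : 0 < n -> \sum_(a < n.+1) (a * x == n : nat) = (x %| n).
Proof.
move=> n_gt0; have [->|x_gt0] := posnP x.
  by rewrite dvd0n big1 => [|a _]; rewrite ?muln0; lia.
have := sum_affine_eq n 0 0 x_gt0; rewrite mul0n addn0 n_gt0 subn0 /= => <-.
apply: eq_bigr => a _; rewrite addn0.
by case: (posnP a) => [->|//]; rewrite mul0n; lia.
Qed.

Lemma card_solutionsE n x y : #|solutions n x y| =
  \sum_(b < n.+1) \sum_(a < n.+1) [&& 0 < a, 0 < b & a * x + b * y == n].
Proof.
rewrite exchange_big /= (pair_bigA _ (fun a b : 'I_n.+1 =>
  [&& 0 < a, 0 < b & a * x + b * y == n] : nat)) -sum1_card big_mkcond /=.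
by apply: eq_bigr => -[a b] _; rewrite inE.
Qed.

Lemma card_solutionsC n x y : #|solutions n x y| = #|solutions n y x|.
Proof.
rewrite !card_solutionsE exchange_big; apply: eq_bigr => a _; apply: eq_bigr => b _.
by rewrite andbCA addnC.
Qed.

Lemma card_solutions_dvdn n x y : 0 < x ->
  #|solutions n x y| = \sum_(b < n.+1) [&& 0 < b, b * y < n & x %| n - b * y].
Proof.
move=> x_gt0; rewrite card_solutionsE; apply: eq_bigr => b _.
have [->|b_gt0] := posnP b; first by rewrite big1 // => a _; rewrite andbF.
by have := sum_affine_eq n (b * y) 0 x_gt0; rewrite mul0n add0n => <-.
Qed.

Lemma card_solutions_out n x y : n < y -> #|solutions n x y| = 0.
Proof.
move=> lt_ny; rewrite card_solutionsE big1 // => b _; rewrite big1 // => a _.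
by apply/eqP; rewrite eqb0; apply/negP => /and3P[_ b_gt0 /eqP]; nia.
Qed.

(* The solutions of [a x + b y = n] with [a > b] are those of
   [a' x + b (x + y) = n], with [a' = a - b]. *)
Lemma sum_solutions_gt n x y : 0 < x ->
  \sum_(b < n.+1) \sum_(a < n.+1) [&& 0 < b, b < a & a * x + b * y == n]
  = #|solutions n x (x + y)|.
Proof.
move=> x_gt0; rewrite card_solutions_dvdn //; apply: eq_bigr => b _.
have [->|b_gt0] := posnP b; first by rewrite big1.
rewrite /= sum_affine_eq // mulnDr; congr nat_of_bool; case: ltnP => //= lt_n.
have -> : n - b * y = n - (b * x + b * y) + b * x by lia.
by rewrite dvdn_addl // dvdn_mull.
Qed.

Lemma card_solutions_split n x y : 0 < n -> 0 < x -> 0 < y ->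
  #|solutions n x y| =
  #|solutions n x (x + y)| + #|solutions n y (x + y)| + (x + y %| n).
Proof.
move=> n_gt0 x_gt0 y_gt0; rewrite -sum_solutions_gt // [in #|solutions n y _|]addnC.
rewrite -sum_solutions_gt // [X in _ + X + _]exchange_big -sum_muln_eq //.
rewrite card_solutionsE -!big_split; apply: eq_bigr => b _ /=.
have -> : (b * (x + y) == n : nat) =
    \sum_(a < n.+1) (a == b :> nat) * (b * (x + y) == n).
  by rewrite -big_distrl /= sum_eq_ord ltn_ord mul1n.
rewrite -!big_split; apply: eq_bigr => a _ /=; rewrite [b * y + _]addnC.
have [->|b_gt0] := posnP b.
  by rewrite !mul0n [0 == n]ltn_eqF // muln0 !ltn0 !andbF.
have [lt_ab|lt_ba|->] := ltngtP a b.
- by rewrite mul0n addn0.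
- by rewrite (ltn_trans b_gt0 lt_ba) mul0n !addn0.
- by rewrite b_gt0 mul1n -mulnDr.
Qed.

Lemma odd_card_solutions_diag n x : 0 < n -> 0 < x ->
  odd #|solutions n x x| = (x.*2 %| n).
Proof.
by move=> n_gt0 x_gt0; rewrite card_solutions_split // !oddD addbb addnn oddb.
Qed.

(** * The formula modulo 8 *)

Lemma card_hook_codes k n : 0 < n ->
  #|hook_codes k n| = \sum_(s < n.+1) (s %| n) * minn k s.
Proof.
move=> n_gt0; rewrite (card_dep_pair (fun u : 'I_n.+1 * 'I_n.+1 => u.1 * u.2 == n)
  (fun u (j : 'I_k) => j < u.2)) big_mkcond /=.
rewrite -(pair_bigA _ (fun b s : 'I_n.+1 =>
  if b * s == n then #|[set j : 'I_k | j < s]| else 0)) exchange_big /=.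
apply: eq_bigr => s _; rewrite -sum_muln_eq // big_distrl; apply: eq_bigr => b _ /=.
case: (_ == n); rewrite ?mul1n // minnC -sum_ltn cardsE -sum1_card big_mkcond.
exact: eq_bigr.
Qed.

Lemma card_hook_codes_mod k n : 0 < n ->
  #|hook_codes k n| = \sum_(s < k) (s %| n) * s %[mod k].
Proof.
move=> n_gt0; rewrite card_hook_codes //.
pose small s := (s < k) * ((s %| n) * s).
have -> : \sum_(s < k) (s %| n) * s = \sum_(s < n.+1) small s.
  rewrite (@eq_sum_trunc n.+1 k) => [|s].
    by apply: eq_bigr => s _; rewrite /small ltn_ord mul1n.
  rewrite /small geq_min => /orP[/gtnNdvd->|]; rewrite ?mul0n ?muln0 //.
  by rewrite leqNgt => /negbTE->.
have -> : \sum_(s < n.+1) (s %| n) * minn k s =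
    (\sum_(s < n.+1) (s %| n) * (k <= s)) * k + \sum_(s < n.+1) small s.
  rewrite big_distrl -big_split /=; apply: eq_bigr => s _; rewrite /small.
  by case: leqP; rewrite ?muln1 ?muln0 ?mul0n ?mul1n ?addn0.
by rewrite modnMDl.
Qed.

Lemma card_ribbon_codes k n : #|ribbon_codes k n| =
  \sum_(r < n.+1) \sum_(s < n.+1) #|solutions n r (r + s)| * #|hook_ribbons k r s|.
Proof.
rewrite (card_dep_pair xpredT (fun (s : 'I_n.+1 * 'I_n.+1) q =>
  (q.1 \in solutions n s.1 (s.1 + s.2)) && (q.2 \in hook_ribbons k s.1 s.2))).
rewrite (pair_bigA _ (fun r s : 'I_n.+1 =>
  #|solutions n r (r + s)| * #|hook_ribbons k r s|)) /=.
apply: eq_bigr => -[r s] _; rewrite -cardsX; apply: eq_card => -[u q].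
by rewrite !inE.
Qed.

(* Modulo 2, the number of solutions of [a r + b s = n] with [a] and [b] distinct. *)
Definition pair_weight (n r s : nat) : nat := #|solutions n r s| + (r + s %| n).

Lemma pair_weight_out n r s : 0 < n -> n < s -> pair_weight n r s = 0.
Proof.
by move=> n_gt0 lt_ns; rewrite /pair_weight card_solutions_out // gtnNdvd // ltn_addl.
Qed.

Lemma odd_card_ribbon_codes k n : ~~ odd k -> 0 < n ->
  odd #|ribbon_codes k n| =
  odd (\sum_(r < n.+1) \sum_(s < n.+1)
         ((r < s) && hook_ribbon_parity k r s) * pair_weight n r s).
Proof.
move=> even_k n_gt0; rewrite card_ribbon_codes.
pose term (r s : nat) := hook_ribbon_parity k r s * #|solutions n r (r + s)|.
transitivity (odd (\sum_(r < n.+1) \sum_(s < n.+1)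
                     ((r < s) * term r s + (s < r) * term r s))).
  do 2!apply: eq_odd_sum => ? _.
  rewrite /term oddM odd_card_hook_ribbons // -mulnDl !oddM andbC oddb.
  case: ltngtP => //= ->.
  by rewrite /hook_ribbon_parity oddD addbb eqxx !andbF.
under eq_bigr do rewrite big_split.
rewrite big_split /= [X in _ + X]exchange_big -big_split.
apply: eq_odd_sum => r _; rewrite -big_split; apply: eq_odd_sum => s _ /=.
rewrite -mulnDr !oddM !oddb; case: ltnP => //= lt_rs.
rewrite /term hook_ribbon_parityC -mulnDr oddM oddb.
case: (boolP (hook_ribbon_parity k s r)) => //= /and3P[s_gt0 r_gt0 _].
rewrite /pair_weight card_solutions_split // [s + r]addnC.
by rewrite -addnA addnn [in RHS]oddD odd_double addbF.
Qed.

Lemma sum_eq_odd_index n m : \sum_(c < n) (m == c.*2.+1 : nat) = odd m && (m < n.*2).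
Proof.
transitivity (\sum_(c < n) odd m * (c == m./2 :> nat)).
  by apply: eq_bigr => c _; lia.
by rewrite -big_distrr /= sum_eq_ord; lia.
Qed.

Section GapSums.
Variables (n : nat) (F : nat -> nat -> nat).
Hypothesis F_out : forall r s, n < s -> F r s = 0.

Lemma sum_delta r m : \sum_(s < n.+1) (s == m :> nat) * F r s = F r m.
Proof.
transitivity (\sum_(s < n.+1) (s == m :> nat) * F r m).
  by apply: eq_bigr => s _; case: eqP => [->|].
by rewrite -big_distrl /= sum_eq_ord; case: ltnP => [|/F_out->]; rewrite ?mul1n.
Qed.

Lemma sum_odd_gap h :
  \sum_(r < n.+1) \sum_(s < n.+1)
     [&& 0 < r, r < s, odd (s - r) & s - r < h.*2] * F r s
  = \sum_(c < h) \sum_(r < n) F r.+1 (r.+1 + c.*2.+1).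
Proof.
rewrite [RHS]exchange_big big_ord_recl big1 //= add0n; apply: eq_bigr => r _.
under [RHS]eq_bigr do rewrite -sum_delta.
rewrite exchange_big; apply: eq_bigr => s _; rewrite -big_distrl; congr (_ * _).
transitivity ((r.+1 < s) * \sum_(c < h) (s - r.+1 == c.*2.+1)).
  by rewrite sum_eq_odd_index mulnb.
by rewrite big_distrr; apply: eq_bigr => c _ /=; lia.
Qed.

Lemma sum_odd_sum h :
  \sum_(r < n.+1) \sum_(s < n.+1)
     [&& 0 < r, r < s, odd (r + s) & r + s < h.*2] * F r s
  = \sum_(c < h) \sum_(x < c) F x.+1 (c.*2 - x).
Proof.
transitivity (\sum_(c < h) \sum_(x < n) (x < c) * F x.+1 (c.*2 - x)); last first.
  apply: eq_bigr => c _.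
  rewrite (@eq_sum_trunc n c (fun x => (x < c) * F x.+1 (c.*2 - x))).
    by apply: eq_bigr => x _; rewrite ltn_ord mul1n.
  by move=> x; case: ltnP => //= lt_xc ?; rewrite F_out //; lia.
rewrite [RHS]exchange_big big_ord_recl big1 //= add0n; apply: eq_bigr => x _.
under [RHS]eq_bigr do rewrite -sum_delta big_distrr.
rewrite exchange_big; apply: eq_bigr => s _ /=.
under [RHS]eq_bigr do rewrite mulnA.
rewrite -big_distrl; congr (_ * _).
transitivity ((x.+1 < s) * \sum_(c < h) (x.+1 + s == c.*2.+1)).
  by rewrite sum_eq_odd_index mulnb.
by rewrite big_distrr; apply: eq_bigr => c _ /=; lia.
Qed.

End GapSums.

Section Telescoping.
Variable n : nat.
Hypothesis n_gt0 : 0 < n.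

Lemma sum_solutions_gap d : 0 < d ->
  \sum_(r < n) #|solutions n r.+1 (r.+1 + d)| + \sum_(r < n) (r.+1 + d %| n) =
  \sum_(e < d) #|solutions n e.+1 d|.
Proof.
move=> d_gt0; under [RHS]eq_bigr do rewrite card_solutionsC.
pose h e := #|solutions n d e.+1|.
have h_out e : n <= e -> h e = 0 by move=> le_ne; apply: card_solutions_out.
have sum_h : \sum_(r < n) h r = \sum_(r < n) #|solutions n r.+1 (r.+1 + d)|
    + \sum_(r < n) (r.+1 + d %| n) + \sum_(r < n) h (d + r).
  rewrite -!big_split; apply: eq_bigr => r _ /=.
  by rewrite /h card_solutions_split // -addnS [r.+1 + d]addnC -addnA addnC.
have : \sum_(r < d + n) h r = \sum_(r < n) h r.
  by apply: eq_sum_trunc => e; rewrite (minn_idPr (leq_addl d n)); apply: h_out.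
by rewrite big_split_ord /= sum_h => /addIn.
Qed.

Lemma sum_solutions_sum c :
  \sum_(x < c) #|solutions n x.+1 (c.*2 - x)| =
  \sum_(e < c.*2) #|solutions n e.+1 c.*2.+1| + c * (c.*2.+1 %| n).
Proof.
rewrite -addnn big_split_ord /= [X in _ + X + _](reindex_inj rev_ord_inj) /=.
rewrite -[c in c * _]card_ord -sum_nat_const -!big_split; apply: eq_bigr => x _ /=.
have lt_xc := ltn_ord x.
rewrite card_solutions_split //; last lia.
have -> : x.+1 + (c + c - x) = (c + c).+1 by lia.
by have -> : (c + (c - x.+1)).+1 = c + c - x by lia.
Qed.

Lemma sum_dvdn_double c :
  odd (\sum_(r < n) (r.+1 + c.*2.+1 %| n)
       + \sum_(r < n) (r.+1 + (r.+1 + c.*2.+1) %| n))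
  = odd (\sum_(t < n) ((c + t).+1.*2 %| n)).
Proof.
have <- : \sum_(r < n.*2) (r.+1 + c.*2.+1 %| n) = \sum_(r < n) (r.+1 + c.*2.+1 %| n).
  apply: (@eq_sum_trunc _ _ (fun r => r.+1 + c.*2.+1 %| n)) => r le_r.
  by rewrite gtnNdvd //; lia.
rewrite (sum_double n (fun r => r.+1 + c.*2.+1 %| n)) -addnA -big_split oddD.
rewrite [X in _ (+) odd X](_ : _ = (\sum_(r < n) (r.*2.+2 + c.*2.+1 %| n)).*2).
  rewrite odd_double addbF; congr odd; apply: eq_bigr => t _.
  by congr (nat_of_bool (_ %| _)); lia.
rewrite -[RHS]addnn -big_split; apply: eq_bigr => r _ /=.
by congr (_ + nat_of_bool (_ %| _)); lia.
Qed.

Lemma odd_sum_pair_weight c :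
  odd (\sum_(r < n) pair_weight n r.+1 (r.+1 + c.*2.+1)
       + \sum_(x < c) pair_weight n x.+1 (c.*2 - x))
  = odd ((c.*2.+1.*2 %| n) + \sum_(t < n) ((c + t).+1.*2 %| n)).
Proof.
rewrite /pair_weight !big_split /= sum_solutions_sum.
have -> : \sum_(x < c) (x.+1 + (c.*2 - x) %| n) = c * (c.*2.+1 %| n).
  rewrite -[c in c * _]card_ord -sum_nat_const; apply: eq_bigr => x _.
  by congr (nat_of_bool (_ %| _)); have := ltn_ord x; lia.
have := sum_solutions_gap (ltn0Sn c.*2); rewrite big_ord_recr /=.
move/(congr1 odd); rewrite !oddD odd_card_solutions_diag // -sum_dvdn_double.
rewrite !oddD !oddb addbK.
move: (odd (\sum_(r < n) #|_|)) (odd (\sum_(r < n) (_ + c.*2.+1 %| n))) => b1 b2.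
move: (odd (\sum_(r < n) (_ + _ %| n))) (odd (\sum_(e < c.*2) _)) => b3 b4.
by case: (_.*2 %| n) b1 b2 b3 b4 => [] [] [] [] [].
Qed.

End Telescoping.

Lemma hook_ribbon_parity_addb k r s : ~~ odd k -> (r < s) && hook_ribbon_parity k r s =
  [&& 0 < r, r < s, odd r, odd s & s < k] (+) [&& 0 < r, r < s, odd (s - r) & s - r < k]
  (+) [&& 0 < r, r < s, odd (r + s) & r + s < k].
Proof.
move=> even_k; have [lt_rs|le_sr] := ltnP r s; last by rewrite !andbF.
have [->|r_gt0] := posnP r; first by rewrite andbF.
rewrite /hook_ribbon_parity r_gt0 (ltn_trans r_gt0 lt_rs) ltn_eqF //=.
rewrite oddB ?(ltnW lt_rs) // addbC.
have -> : r < s + k by lia.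
have -> : (s < r + k) = (s - r < k) by lia.
have k_neq : odd (r + s) -> r + s != k by case: eqP even_k => // <- /negbTE->.
have -> : odd (r + s) && ((s - r < k) && (k < r + s)) =
    odd (r + s) && ((s - r < k) (+) (r + s < k)).
  by case: (odd (r + s)) k_neq => // /(_ isT); lia.
have -> : (r < k) && (s < k) = (s < k) by lia.
rewrite oddD.
by case: (odd r) (odd s) (s - r < k) (r + s < k) (s < k) => [] [] [] [] [].
Qed.

Lemma odd_sum_windows l n (F : nat -> nat) : (forall t, n <= t -> F t = 0) ->
  odd (\sum_(c < l.*2) \sum_(t < n) F (c + t)) = odd (\sum_(i < l) F i.*2).
Proof.
move=> F_out; rewrite (sum_double l (fun c => \sum_(t < n) F (c + t))) -big_split.
apply: eq_odd_sum => i _ /=.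
have <- : \sum_(t < n.+1) F (i.*2 + t) = \sum_(t < n) F (i.*2 + t).
  apply: (eq_sum_trunc (F := fun t => F (i.*2 + t))) => t.
  rewrite (minn_idPr (leqnSn n)) => le_nt.
  by rewrite F_out // (leq_trans le_nt) ?leq_addl.
rewrite big_ord_recl /= addn0 oddD.
under eq_bigr do rewrite /bump leq0n add1n addnS -addSn.
by rewrite oddD addbK.
Qed.

Definition odd_sizes_sum (k n : nat) : nat :=
  \sum_(s < k | odd s) \sum_(r < s | odd r) pair_weight n r s.

Lemma sum_odd_sizes k n : 0 < n ->
  \sum_(r < n.+1) \sum_(s < n.+1)
     [&& 0 < r, r < s, odd r, odd s & s < k] * pair_weight n r s = odd_sizes_sum k n.
Proof.
move=> n_gt0; pose row s := \sum_(r < n.+1)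
  [&& 0 < r, r < s, odd r, odd s & s < k] * pair_weight n r s.
rewrite exchange_big (@eq_sum_trunc n.+1 k row) => [|s]; last first.
  rewrite geq_min /row => /orP[lt_ns|le_ks]; rewrite big1 // => r _.
    by rewrite pair_weight_out ?muln0.
  by rewrite [s < k]ltnNge le_ks !andbF.
rewrite /odd_sizes_sum [RHS]big_mkcond; apply: eq_bigr => s _; rewrite /row ltn_ord.
have [odd_s|] := ifP; last by move=> even_s; rewrite big1 // => r _; rewrite !andbF.
rewrite (@eq_sum_trunc n.+1 s
  (fun r => [&& 0 < r, r < s, odd r, true & true] * pair_weight n r s)).
  rewrite [RHS]big_mkcond; apply: eq_bigr => r _; rewrite ltn_ord.
  by rewrite !andbT; case: r => -[|r] //= _; case: ifP; rewrite ?mul1n.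
move=> r; rewrite geq_min => /orP[lt_nr|]; last first.
  by rewrite leqNgt => /negbTE->; rewrite !andbF.
have [lt_rs|] := ltnP r s; last by rewrite !andbF.
by rewrite pair_weight_out ?muln0 // (ltn_trans _ lt_rs).
Qed.

Lemma odd_card_ribbon_codes_mul4 l n : 0 < n ->
  odd #|ribbon_codes (4 * l) n| =
  odd (odd_sizes_sum (4 * l) n + \sum_(l <= i < l.*2) (i.*2.+1.*2 %| n)).
Proof.
move=> n_gt0; have -> : 4 * l = l.*2.*2 by lia.
rewrite odd_card_ribbon_codes ?odd_double //.
have W_out r s : n < s -> pair_weight n r s = 0 by apply: pair_weight_out.
pose part_sum (P : nat -> nat -> bool) :=
  \sum_(r < n.+1) \sum_(s < n.+1) P r s * pair_weight n r s.
transitivity (odd (odd_sizes_sum l.*2.*2 n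
  + part_sum (fun r s => [&& 0 < r, r < s, odd (s - r) & s - r < l.*2.*2])
  + part_sum (fun r s => [&& 0 < r, r < s, odd (r + s) & r + s < l.*2.*2]))).
  rewrite -sum_odd_sizes // -!big_split; apply: eq_odd_sum => r _ /=.
  rewrite -!big_split; apply: eq_odd_sum => s _ /=.
  by rewrite hook_ribbon_parity_addb ?odd_double // !(oddD, oddM, oddb) !andb_addl.
rewrite /part_sum sum_odd_gap // sum_odd_sum // -addnA !oddD; congr (_ (+) _).
rewrite -oddD -big_split /=.
have /eq_odd_sum-> : forall c : 'I_l.*2, true ->
    odd (\sum_(r < n) pair_weight n r.+1 (r.+1 + c.*2.+1)
         + \sum_(x < c) pair_weight n x.+1 (c.*2 - x))
    = odd ((c.*2.+1.*2 %| n) + \sum_(t < n) ((c + t).+1.*2 %| n)).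
  by move=> c _; apply: odd_sum_pair_weight.
rewrite big_split oddD (odd_sum_windows l (F := fun t => t.+1.*2 %| n)) => [|t le_nt].
  rewrite -(big_mkord xpredT (fun c => c.*2.+1.*2 %| n : nat)).
  rewrite -(big_mkord xpredT (fun i => i.*2.+1.*2 %| n : nat)).
  rewrite (big_cat_nat (leq0n l) (_ : l <= l.*2)) /=; last by rewrite -addnn leq_addr.
  by rewrite oddD addbAC addbb.
by rewrite gtnNdvd //; lia.
Qed.

Lemma pl_over_mod8_formula l n : 0 < n ->
  pl_over (4 * l) n = 2 * (\sum_(s < 4 * l) (s %| n) * s)
    + 4 * (odd_sizes_sum (4 * l) n + \sum_(l <= i < l.*2) (i.*2.+1.*2 %| n)) %[mod 8].
Proof.
move=> n_gt0; rewrite pl_over_mod8_free_cells // card_one_free_cell //.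
rewrite card_two_free_cells //.
have := odd_card_ribbon_codes_mul4 l n_gt0.
have := card_hook_codes_mod (4 * l) n_gt0.
move/(congr1 (modn^~ 4)); rewrite !modn_dvdm ?dvdn_mulr //.
move: #|_| #|_| (\sum_(s < _) _) (_ + _) => hooks ribbons hook_sum ribbon_sum.
by lia.
Qed.

(** * Periodicity *)

Lemma card_solutions_sum n x y : 0 < x -> 0 < y ->
  #|solutions n x y| = \sum_(b < n.-1 %/ y) (x %| n - b.+1 * y).
Proof.
move=> x_gt0 y_gt0; rewrite card_solutions_dvdn // big_ord_recl add0n /=.
pose term b := (b.+1 * y < n) && (x %| n - b.+1 * y) : nat.
have lt_div b : (b.+1 * y < n) = (b < n.-1 %/ y) by rewrite leq_divRL //; lia.
transitivity (\sum_(b < n) term b); first by apply: eq_bigr.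
rewrite (@eq_sum_trunc n (n.-1 %/ y) term) => [|b].
  by apply: eq_bigr => b _; rewrite /term lt_div ltn_ord.
rewrite geq_min /term lt_div ltnNge => /orP[le_nb|-> //].
by rewrite (leq_trans (leq_div _ _)) // (leq_trans (leq_pred n)).
Qed.

Lemma card_solutions_add n x y P : 0 < n -> 0 < x -> 0 < y -> y %| P -> x %| P ->
  #|solutions (n + P) x y| =
  \sum_(b < P %/ y) (x %| n + P - b.+1 * y) + #|solutions n x y|.
Proof.
move=> n_gt0 x_gt0 y_gt0 y_dvd x_dvd; rewrite !card_solutions_sum //.
have -> : (n + P).-1 %/ y = P %/ y + n.-1 %/ y.
  by rewrite -divnDl // -(prednK n_gt0) addSn addnC.
rewrite big_split_ord /=; congr (_ + _); apply: eq_bigr => b _.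
by rewrite -addnS mulnDl divnK // [n + P]addnC subnDl.
Qed.

Lemma odd_card_solutions_period n x y P :
  0 < n -> 0 < x -> 0 < y -> x %| P -> y %| P ->
  odd #|solutions (n + P.*2) x y| = odd #|solutions n x y|.
Proof.
move=> n_gt0 x_gt0 y_gt0 x_dvd y_dvd.
rewrite -addnn addnA !card_solutions_add ?addn_gt0 ?n_gt0 // addnA oddD.
suff -> : \sum_(b < P %/ y) (x %| n + P + P - b.+1 * y) =
          \sum_(b < P %/ y) (x %| n + P - b.+1 * y) by rewrite addnn odd_double.
apply: eq_bigr => b _; have le_bP : b.+1 * y <= P by rewrite -leq_divRL.
by rewrite -addnBAC ?dvdn_addl // (leq_trans le_bP) ?leq_addl.
Qed.

Section Period.
Variables (l P n : nat).
Hypotheses (n_gt0 : 0 < n) (P_multiple : forall s, 0 < s < 4 * l -> s %| P).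

Let dvdn_period s : s %| P.*2 -> (s %| n + P.*2) = (s %| n).
Proof. exact: dvdn_addl. Qed.

Let double_dvd s : 0 < s < 4 * l -> s.*2 %| P.*2.
Proof. by move=> s_range; rewrite -!muln2 dvdn_pmul2r // P_multiple. Qed.

Lemma odd_odd_sizes_sum_period :
  odd (odd_sizes_sum (4 * l) (n + P.*2)) = odd (odd_sizes_sum (4 * l) n).
Proof.
apply: eq_odd_sum => s odd_s; apply: eq_odd_sum => r odd_r.
have lt_rs := ltn_ord r; have lt_sk := ltn_ord s.
have r_gt0 : 0 < r by case: (nat_of_ord r) odd_r.
have rsE : (r + s)./2.*2 = r + s by rewrite -[RHS]odd_double_half oddD odd_r odd_s.
have s_gt0 : 0 < s := ltn_trans r_gt0 lt_rs.
have r_lt : r < 4 * l := ltn_trans lt_rs lt_sk.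
rewrite /pair_weight !oddD odd_card_solutions_period ?P_multiple ?r_gt0 ?s_gt0 //.
by rewrite dvdn_period // -rsE double_dvd // half_gt0 ltn_half_double; lia.
Qed.

Lemma pl_over_period : pl_over (4 * l) (n + P.*2) = pl_over (4 * l) n %[mod 8].
Proof.
rewrite !pl_over_mod8_formula // ?addn_gt0 ?n_gt0 //.
have -> : \sum_(s < 4 * l) (s %| n + P.*2) * s = \sum_(s < 4 * l) (s %| n) * s.
  apply: eq_bigr => s _; have [->|s_gt0] := posnP s; first by rewrite !muln0.
  by rewrite dvdn_period // -muln2 dvdn_mulr // P_multiple // s_gt0 ltn_ord.
have -> : \sum_(l <= i < l.*2) (i.*2.+1.*2 %| n + P.*2) =
          \sum_(l <= i < l.*2) (i.*2.+1.*2 %| n).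
  rewrite big_nat [RHS]big_nat; apply: eq_bigr => i /andP[_ lt_i].
  by rewrite dvdn_period // double_dvd //; lia.
have := odd_odd_sizes_sum_period; move: (odd_sizes_sum _ _) (odd_sizes_sum _ _).
by move: (\sum_(s < _) _) (\sum_(l <= i < _) _); lia.
Qed.

End Period.

(* An executable form of the right-hand side of [pl_over_mod8_formula]. *)
Definition pl_over_residue (l n : nat) : nat :=
  (2 * sumn [seq (s %| n) * s | s <- iota 0 (4 * l)]
   + 4 * (sumn [seq sumn [seq count (fun b => r %| n - b.+1 * s) (iota 0 (n.-1 %/ s))
                              + (r + s %| n) | r <- iota 0 s & odd r]
               | s <- iota 0 (4 * l) & odd s]
          + count (fun i => i.*2.+1.*2 %| n) (iota l l))) %% 8.

Lemma pl_over_residueE l n : 0 < n -> pl_over (4 * l) n %% 8 = pl_over_residue l n.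
Proof.
move=> n_gt0; rewrite pl_over_mod8_formula // /pl_over_residue.
rewrite (sum_iota xpredT _ (fun s => (s %| n) * s)) filter_predT.
rewrite /odd_sizes_sum.
rewrite (sum_iota odd _ (fun s => \sum_(r < s | odd r) pair_weight n r s)).
congr ((_ + 4 * (sumn _ + _)) %% _).
  apply/eq_in_map => s; rewrite mem_filter => /andP[odd_s _].
  rewrite (sum_iota odd _ (fun r => pair_weight n r s)); congr sumn.
  apply/eq_in_map => r; rewrite mem_filter => /andP[odd_r _].
  rewrite /pair_weight card_solutions_sum; [|by case: r odd_r|by case: s odd_s].
  rewrite (sum_iota xpredT _ (fun b => r %| n - b.+1 * s : nat)) filter_predT.
  by rewrite sumn_count.
by rewrite -sumn_count sumnE big_map /index_iota -addnn addnK.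
Qed.

Lemma pl_over_progression_mod8 l P a c m n :
  all (dvdn^~ P) (iota 1 (4 * l).-1) -> P.*2 = a * m -> 0 < a * m -> 0 < n ->
  all (fun i => pl_over_residue l (a * i.+1 + c) == 0) (iota 0 m) ->
  pl_over (4 * l) (a * n + c) = 0 %[mod 8].
Proof.
move=> /allP P_multiple PE; rewrite muln_gt0 => /andP[a_gt0 m_gt0] n_gt0 /allP residues.
have multiple s : 0 < s < 4 * l -> s %| P.
  by move=> s_range; apply: P_multiple; rewrite mem_iota; lia.
pose i := n.-1 %% m; have lt_im : i < m by rewrite ltn_mod.
have -> : a * n + c = a * i.+1 + c + n.-1 %/ m * P.*2.
  by rewrite PE -{1}(prednK n_gt0) {1}(divn_eq n.-1 m) -/i; nia.
elim: (n.-1 %/ m) => [|q IH].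
  rewrite mul0n addn0 pl_over_residueE ?addn_gt0 ?muln_gt0 ?a_gt0 //.
  by apply/eqP/residues; rewrite mem_iota.
by rewrite [q.+1 * _]mulSnr addnA pl_over_period // !addn_gt0 muln_gt0 a_gt0.
Qed.

Theorem theorem1p8 (n : nat) (hn : 1 <= n) :
  (pl_over 4 (12 * n) = 0 %[mod 8]
   /\ pl_over 4 (6 * n + 3) = 0 %[mod 8]) /\
  [/\ pl_over 8 (210 * n) = 0 %[mod 8],
      pl_over 8 (210 * n + 3) = 0 %[mod 8],
      pl_over 8 (210 * n + 9) = 0 %[mod 8]
    & pl_over 8 (210 * n + 105) = 0 %[mod 8]].
Proof.
have vanish4 a c m : 12 = a * m ->
    all (fun i => pl_over_residue 1 (a * i.+1 + c) == 0) (iota 0 m) ->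
    pl_over 4 (a * n + c) = 0 %[mod 8].
  by move=> am; apply: (@pl_over_progression_mod8 1 6) => //; rewrite -am.
have vanish8 c : all (fun i => pl_over_residue 2 (210 * i.+1 + c) == 0) (iota 0 4) ->
    pl_over 8 (210 * n + c) = 0 %[mod 8].
  by apply: (@pl_over_progression_mod8 2 420).
split; split.
- by rewrite -[12 * n]addn0; apply: (vanish4 12 0 1); vm_compute.
- by apply: (vanish4 6 3 2); vm_compute.
- by rewrite -[210 * n]addn0; apply: vanish8; vm_compute.
- by apply: vanish8; vm_compute.
- by apply: vanish8; vm_compute.
- by apply: vanish8; vm_compute.
Qed.
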